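(* Let $\mathbf{k}$ be a field. The category Nil-dgvect is a symmetric monoidal category. Nil-dga is the category of monoids in Nil-dgvect. Nil-dga inherits a symmetric monoidal structure from Nil-dgvect.
   Context: For an integer $N\ge 1$, an $N$-complex is a pair $(A^\bullet,d)$, where $A^\bullet=\oplus_{i\in\mathbb{Z}}A^i$ is $\mathbb{Z}$-graded and $d:A^\bullet\to A^\bullet$ is a morphism of degree $1$ with $d^N=0$; over a field $\mathbf{k}$ it is called an $N$-differential graded vector space ($N$-dgvect). Nil-dgvect is the category whose objects are the $N$-differential graded vector spaces for some integer $N\ge 2$ ($N$ may vary with the object); a morphism $f:(A^\bullet,d_A)\to(B^\bullet,d_B)$ from an $M$-complex to an $N$-complex is a $\mathbf{k}$-linear map $f:A^\bullet\to B^\bullet$ with $d_Bf=fd_A$. An $N$-differential graded algebra ($N$-dga) is a triple $(A^\bullet,m,d)$ with $m:A^k\otimes A^l\to A^{k+l}$ and $d:A^k\to A^{k+1}$ linear, such that $(A^\bullet,m)$ is a graded associative algebra, $d(ab)=d(a)b+(-1)^{\bar a}a\,d(b)$ (where $\bar a$ is the degree of $a$), and $d^N=0$. A nilpotent differential graded algebra (Nil-dga) is an $N$-dga for some integer $N\ge 2$; these are the objects of the category Nil-dga. A morphism $f$ from an $M$-dga $(A^\bullet,m_A,d_A)$ to an $N$-dga $(B^\bullet,m_B,d_B)$ is a linear map with $fm_A=m_B(f\otimes f)$ and $d_Bf=fd_A$; it is said to be of degree $k$ if $f(A^i)\subset B^{i+k}$ for all $i$. The tensor product of $(A^\bullet,d_A)$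 and $(B^\bullet,d_B)$ is $A^\bullet\otimes B^\bullet$ with $d_{A\otimes B}=d_A\otimes Id+Id\otimes d_B$, i.e. $d_{A\otimes B}(a\otimes b)=d_A(a)\otimes b+(-1)^{\bar a}a\otimes d_B(b)$; for algebras the product on it is $m_{A\otimes B}=m_A\otimes m_B$ (understood with the Koszul sign rule, $(a\otimes b)(a'\otimes b')=(-1)^{\bar b\,\bar a'}aa'\otimes bb'$). The tensor product of an $M$-dga and an $N$-dga is an $(M+N-1)$-dga.
   Formalization: Morphisms in Nil-dgvect and Nil-dga are required to have degree 0 (for arbitrary linear maps commuting with d, f⊗g need not commute with the signed differential, and monoids need not be graded algebras); algebras and their morphisms are taken unital. *)

(* Defs.v *)
From HB Require Import structures.
From mathcomp Require Import all_boot all_order all_algebra.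
From mathcomp Require Import boolp.
Set Implicit Arguments.
Unset Strict Implicit.
Unset Printing Implicit Defensive.
Import GRing.Theory.
Local Open Scope ring_scope.
Local Obligation Tactic := idtac.

Declare Scope cat_scope.
Delimit Scope cat_scope with cat.

Record category := Category {
  Ob :> Type;
  hom : Ob -> Ob -> Type;
  idc : forall X, hom X X;
  comp : forall X Y Z, hom Y Z -> hom X Y -> hom X Z;
  comp1c : forall X Y (f : hom X Y), comp (idc Y) f = f;
  compc1 : forall X Y (f : hom X Y), comp f (idc X) = f;
  compA : forall X Y Z W (h : hom Z W) (g : hom Y Z) (f : hom X Y),
    comp h (comp g f) = comp (comp h g) f
}.
Arguments hom {c} X Y.
Arguments idc {c} X.
Arguments comp {c X Y Z} g f.

Notation "g ∘ f" := (comp g f) (at level 40, left associativity) : cat_scope.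
Local Open Scope cat_scope.

Definition is_iso (C : category) (X Y : C) (f : hom X Y) : Prop :=
  exists g : hom Y X, g ∘ f = idc X /\ f ∘ g = idc Y.

Record functor (C D : category) := Functor {
  fob :> C -> D;
  fmap : forall X Y : C, hom X Y -> hom (fob X) (fob Y);
  fmap1 : forall X, fmap (idc X) = idc (fob X);
  fmapM : forall (X Y Z : C) (g : hom Y Z) (f : hom X Y),
    fmap (g ∘ f) = fmap g ∘ fmap f
}.
Arguments fmap {C D} F {X Y} f : rename.

(* An arrow bundled with its source and target: arrows whose endpoints are    *)
(* only propositionally equal are compared through [arr].                     *)
Definition arr (C : category) (X Y : C) (f : hom X Y) :
  {p : C * C & hom p.1 p.2} := existT _ (X, Y) f.

Definition functor_eq (C D : category) (F G : functor C D) : Prop :=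
  (forall X, F X = G X) /\
  (forall (X Y : C) (f : hom X Y), arr (fmap F f) = arr (fmap G f)).

Definition id_functor (C : category) : functor C C :=
  @Functor C C (fun X => X) (fun X Y f => f) (fun=> erefl) (fun _ _ _ _ _ => erefl).

Program Definition comp_functor (C D E : category)
    (G : functor D E) (F : functor C D) : functor C E :=
  @Functor C E (fun X => G (F X)) (fun X Y f => fmap G (fmap F f)) _ _.
Next Obligation. by move=> * /=; rewrite !fmap1. Qed.
Next Obligation. by move=> * /=; rewrite !fmapM. Qed.

Definition is_cat_isomorphism (C D : category) (F : functor C D) : Prop :=
  exists G : functor D C,
    functor_eq (comp_functor G F) (id_functor C) /\
    functor_eq (comp_functor F G) (id_functor D).

Record monoidal (C : category) := Monoidal {
  tens : C -> C -> C;
  tensh : forall X Y X' Y' : C,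
    hom X X' -> hom Y Y' -> hom (tens X Y) (tens X' Y');
  unitc : C;
  assoc : forall X Y Z : C, hom (tens (tens X Y) Z) (tens X (tens Y Z));
  lunit : forall X : C, hom (tens unitc X) X;
  runit : forall X : C, hom (tens X unitc) X;
  tensh1 : forall X Y : C, tensh (idc X) (idc Y) = idc (tens X Y);
  tenshM : forall (X Y X' Y' X'' Y'' : C)
      (f' : hom X' X'') (g' : hom Y' Y'') (f : hom X X') (g : hom Y Y'),
    tensh (f' ∘ f) (g' ∘ g) = tensh f' g' ∘ tensh f g;
  assoc_nat : forall (X Y Z X' Y' Z' : C)
      (f : hom X X') (g : hom Y Y') (h : hom Z Z'),
    assoc X' Y' Z' ∘ tensh (tensh f g) h = tensh f (tensh g h) ∘ assoc X Y Z;
  lunit_nat : forall (X Y : C) (f : hom X Y),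
    lunit Y ∘ tensh (idc unitc) f = f ∘ lunit X;
  runit_nat : forall (X Y : C) (f : hom X Y),
    runit Y ∘ tensh f (idc unitc) = f ∘ runit X;
  assoc_iso : forall X Y Z, is_iso (assoc X Y Z);
  lunit_iso : forall X, is_iso (lunit X);
  runit_iso : forall X, is_iso (runit X);
  pentagon : forall X Y Z W : C,
    assoc X Y (tens Z W) ∘ assoc (tens X Y) Z W =
    tensh (idc X) (assoc Y Z W) ∘ assoc X (tens Y Z) W
      ∘ tensh (assoc X Y Z) (idc W);
  triangle : forall X Y : C,
    tensh (idc X) (lunit Y) ∘ assoc X unitc Y = tensh (runit X) (idc Y)
}.
Arguments tens {C} m X Y.
Arguments tensh {C} m {X Y X' Y'} f g.
Arguments unitc {C} m.
Arguments assoc {C} m X Y Z.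
Arguments lunit {C} m X.
Arguments runit {C} m X.

Record symMonoidal (C : category) := SymMonoidal {
  smc_monoidal :> monoidal C;
  braid : forall X Y : C, hom (tens smc_monoidal X Y) (tens smc_monoidal Y X);
  braid_nat : forall (X Y X' Y' : C) (f : hom X X') (g : hom Y Y'),
    braid X' Y' ∘ tensh smc_monoidal f g = tensh smc_monoidal g f ∘ braid X Y;
  braidK : forall X Y : C, braid Y X ∘ braid X Y = idc (tens smc_monoidal X Y);
  hexagon : forall X Y Z : C,
    assoc smc_monoidal Y Z X ∘ braid X (tens smc_monoidal Y Z)
      ∘ assoc smc_monoidal X Y Z =
    tensh smc_monoidal (idc Y) (braid X Z) ∘ assoc smc_monoidal Y X Z
      ∘ tensh smc_monoidal (braid X Y) (idc Z)
}.
Arguments braid {C} s X Y.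

Definition strict_symMonoidal_functor (C D : category) (U : functor C D)
    (S : symMonoidal C) (T : symMonoidal D) : Prop :=
  [/\ (forall X Y, U (tens S X Y) = tens T (U X) (U Y)) /\
        U (unitc S) = unitc T,
      forall (X Y X' Y' : C) (f : hom X X') (g : hom Y Y'),
        arr (fmap U (tensh S f g)) = arr (tensh T (fmap U f) (fmap U g)),
      forall X Y Z : C,
        arr (fmap U (assoc S X Y Z)) = arr (assoc T (U X) (U Y) (U Z)),
      forall X : C, arr (fmap U (lunit S X)) = arr (lunit T (U X)) /\
        arr (fmap U (runit S X)) = arr (runit T (U X))
    & forall X Y : C, arr (fmap U (braid S X Y)) = arr (braid T (U X) (U Y))].

Record monoid (C : category) (S : monoidal C) := Monoid {
  mon_ob : C;
  mon_mul : hom (tens S mon_ob mon_ob) mon_ob;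
  mon_one : hom (unitc S) mon_ob;
  mon_mulA : mon_mul ∘ tensh S mon_mul (idc mon_ob) =
    mon_mul ∘ tensh S (idc mon_ob) mon_mul ∘ assoc S mon_ob mon_ob mon_ob;
  mon_mul1l : mon_mul ∘ tensh S mon_one (idc mon_ob) = lunit S mon_ob;
  mon_mul1r : mon_mul ∘ tensh S (idc mon_ob) mon_one = runit S mon_ob
}.

Record monoid_hom (C : category) (S : monoidal C) (M N : monoid S) :=
  MonoidHom {
    mon_hom : hom (mon_ob M) (mon_ob N);
    mon_homM : mon_hom ∘ mon_mul M = mon_mul N ∘ tensh S mon_hom mon_hom;
    mon_hom1 : mon_hom ∘ mon_one M = mon_one N
  }.

Lemma monoid_hom_eq (C : category) (S : monoidal C) (M N : monoid S)
  (f g : monoid_hom M N) : mon_hom f = mon_hom g -> f = g.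
Proof.
case: f g => [f fM f1] [g gM g1] /= E; case: _ / E gM g1 => gM g1.
by congr MonoidHom.
Qed.

Program Definition MonoidCat (C : category) (S : monoidal C) : category :=
  @Category (monoid S) (@monoid_hom C S)
    (fun M => @MonoidHom C S M M (idc _) _ _)
    (fun M N P g f => @MonoidHom C S M P (mon_hom g ∘ mon_hom f) _ _) _ _ _.
Next Obligation. by move=> * /=; rewrite comp1c tensh1 compc1. Qed.
Next Obligation. by move=> * /=; rewrite comp1c. Qed.
Next Obligation.
by move=> * /=; rewrite tenshM -compA mon_homM compA mon_homM compA.
Qed.
Next Obligation. by move=> * /=; rewrite -compA !mon_hom1. Qed.
Next Obligation. by move=> *; apply: monoid_hom_eq; rewrite /= comp1c. Qed.
Next Obligation. by move=> *; apply: monoid_hom_eq; rewrite /= compc1. Qed.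
Next Obligation. by move=> *; apply: monoid_hom_eq; rewrite /= compA. Qed.

Definition forget_monoid (C : category) (S : monoidal C) :
  functor (MonoidCat S) C :=
  @Functor (MonoidCat S) C (@mon_ob C S) (fun M N f => mon_hom f)
    (fun=> erefl) (fun _ _ _ _ _ => erefl).

(* A Z-graded vector space is a vector space with a family of subspaces of    *)
(* which it is the internal direct sum.                                       *)
Record gradedVect (k : fieldType) := GradedVect {
  gv_sort :> lmodType k;
  piece : int -> gv_sort -> Prop;
  piece0 : forall i, piece i 0;
  pieceP : forall i (c : k) (x y : gv_sort),
    piece i x -> piece i y -> piece i (c *: x + y);
  piece_sum : forall x : gv_sort, exists (s : seq int) (y : int -> gv_sort),
    (forall i, piece i (y i)) /\ x = \sum_(i <- s) y i;
  piece_free : forall (s : seq int) (y : int -> gv_sort),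
    uniq s -> (forall i, piece i (y i)) -> \sum_(i <- s) y i = 0 ->
    forall i, i \in s -> y i = 0
}.
Arguments piece {k} g i x.

Definition of_degree (k : fieldType) (n : int) (A B : gradedVect k)
    (f : A -> B) : Prop :=
  forall (i : int) (x : A), piece A i x -> piece B (i + n) (f x).

Record nilDgVect (k : fieldType) := NilDgVect {
  nd_graded :> gradedVect k;
  diff : {linear nd_graded -> nd_graded};
  diff_degree : of_degree 1 diff;
  diff_nilp : exists N : nat, (2 <= N)%N /\ forall x, iter N diff x = 0
}.
Arguments diff {k} n.

(* The tensor product of maps is compatible with the Koszul-signed            *)
(* differential only for maps which preserve the parity of degrees, and a     *)
(* product A (x) A -> A makes A a graded algebra only if it has degree 0:     *)
(* morphisms have degree 0.                                                   *)
Record nilDgHom (k : fieldType) (A B : nilDgVect k) := NilDgHom {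
  nd_fun :> {linear A -> B};
  nd_fun_degree : of_degree 0 nd_fun;
  nd_fun_diff : forall x : A, diff B (nd_fun x) = nd_fun (diff A x)
}.

Lemma linear_eq (k : fieldType) (V W : lmodType k) (f g : {linear V -> W}) :
  f =1 g -> f = g.
Proof.
move=> /funext; case: f g => [f cf] [g cg] /= E.
case: _ / E cg => cg; suff -> : cf = cg by [].
case: cf cg => [[fD] [fZ]] [[gD] [gZ]].
by rewrite (Prop_irrelevance fD gD) (Prop_irrelevance fZ gZ).
Qed.

Lemma nilDgHom_eq (k : fieldType) (A B : nilDgVect k) (f g : nilDgHom A B) :
  f =1 g -> f = g.
Proof.
case: f g => [f fdeg fdiff] [g gdeg gdiff] /= /linear_eq E.
by case: _ / E gdeg gdiff => gdeg gdiff; congr NilDgHom.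
Qed.

Program Definition NilDgVectCat (k : fieldType) : category :=
  @Category (nilDgVect k) (@nilDgHom k)
    (fun A => @NilDgHom k A A idfun _ _)
    (fun A B C g f => @NilDgHom k A C (g \o f) _ _) _ _ _.
Next Obligation. by move=> k A i x; rewrite addr0. Qed.
Next Obligation. by []. Qed.
Next Obligation.
move=> k A B C g f i x xi /=; rewrite -[i + 0]addr0.
exact/nd_fun_degree/nd_fun_degree.
Qed.
Next Obligation. by move=> k A B C g f x /=; rewrite !nd_fun_diff. Qed.
Next Obligation. by move=> *; apply: nilDgHom_eq. Qed.
Next Obligation. by move=> *; apply: nilDgHom_eq. Qed.
Next Obligation. by move=> *; apply: nilDgHom_eq. Qed.

Definition koszul (k : fieldType) (n : int) : k := (-1) ^ n.

(* Monoids have units, so algebras and their morphisms are unital; the zero   *)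
(* algebra is allowed, hence [algType] is not used.                           *)
Record dgaOn (k : fieldType) (A : nilDgVect k) := DgaOn {
  dga_mul : {bilinear A -> A -> A};
  dga_one : A;
  dga_mulA : forall a b c,
    dga_mul a (dga_mul b c) = dga_mul (dga_mul a b) c;
  dga_mul1l : forall a, dga_mul dga_one a = a;
  dga_mul1r : forall a, dga_mul a dga_one = a;
  dga_mul_degree : forall i j a b,
    piece A i a -> piece A j b -> piece A (i + j) (dga_mul a b);
  dga_one_degree : piece A 0 dga_one;
  dga_leibniz : forall i a b, piece A i a ->
    diff A (dga_mul a b) =
    dga_mul (diff A a) b + koszul k i *: dga_mul a (diff A b)
}.

Record nilDga (k : fieldType) := NilDga {
  dga_vect :> nilDgVect k;
  dga_str : dgaOn dga_vect
}.

Definition amul (k : fieldType) (A : nilDga k) : A -> A -> A :=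
  dga_mul (dga_str A).
Definition aone (k : fieldType) (A : nilDga k) : A := dga_one (dga_str A).
Arguments amul {k A} a b.
Arguments aone {k} A.

Record nilDgaHom (k : fieldType) (A B : nilDga k) := NilDgaHom {
  dga_fun :> nilDgHom A B;
  dga_funM : forall a b : A, dga_fun (amul a b) = amul (dga_fun a) (dga_fun b);
  dga_fun1 : dga_fun (aone A) = aone B
}.

Lemma nilDgaHom_eq (k : fieldType) (A B : nilDga k) (f g : nilDgaHom A B) :
  dga_fun f = dga_fun g -> f = g.
Proof.
case: f g => [f fM f1] [g gM g1] /= E; case: _ / E gM g1 => gM g1.
by congr NilDgaHom.
Qed.

Program Definition NilDgaCat (k : fieldType) : category :=
  @Category (nilDga k) (@nilDgaHom k)
    (fun A => @NilDgaHom k A A (@idc (NilDgVectCat k) A) _ _)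
    (fun A B C g f =>
       @NilDgaHom k A C (@comp (NilDgVectCat k) A B C g f) _ _) _ _ _.
Next Obligation. by []. Qed.
Next Obligation. by []. Qed.
Next Obligation. by move=> k A B C g f a b /=; rewrite !dga_funM. Qed.
Next Obligation. by move=> k A B C g f /=; rewrite !dga_fun1. Qed.
Next Obligation. by move=> *; apply: nilDgaHom_eq; apply: nilDgHom_eq. Qed.
Next Obligation. by move=> *; apply: nilDgaHom_eq; apply: nilDgHom_eq. Qed.
Next Obligation. by move=> *; apply: nilDgaHom_eq; apply: nilDgHom_eq. Qed.

Definition forget_dga (k : fieldType) :
  functor (NilDgaCat k) (NilDgVectCat k) :=
  @Functor (NilDgaCat k) (NilDgVectCat k) (@dga_vect k)
    (fun A B f => dga_fun f) (fun=> erefl) (fun _ _ _ _ _ => erefl).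

Definition is_tensor_product (k : fieldType) (V W T : lmodType k)
    (t : {bilinear V -> W -> T}) : Prop :=
  forall (Z : lmodType k) (g : {bilinear V -> W -> Z}),
    exists! h : {linear T -> Z}, forall v w, h (t v w) = g v w.

(* [S] is the symmetric monoidal structure given by the graded tensor product *)
(* over k: [t A B a b] is the pure tensor of a and b, and [e] is the element  *)
(* 1 of the unit object, which is k in degree 0.                              *)
Record is_graded_tensor (k : fieldType) (S : symMonoidal (NilDgVectCat k))
    (t : forall A B : nilDgVect k,
           {bilinear A -> B -> (tens S A B : nilDgVect k)})
    (e : (unitc S : nilDgVect k)) : Prop := IsGradedTensor {
  gt_univ : forall A B, is_tensor_product (t A B);
  gt_degree : forall (A B : nilDgVect k) i j (a : A) (b : B),
    piece A i a -> piece B j b ->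
    piece (tens S A B : nilDgVect k) (i + j) (t A B a b);
  gt_diff : forall (A B : nilDgVect k) i (a : A) (b : B), piece A i a ->
    diff (tens S A B) (t A B a b) =
    t A B (diff A a) b + koszul k i *: t A B a (diff B b);
  gt_hom : forall (A B A' B' : nilDgVect k)
      (f : nilDgHom A A') (g : nilDgHom B B') (a : A) (b : B),
    (@tensh _ S A B A' B' f g : nilDgHom _ _) (t A B a b) =
    t A' B' (f a) (g b);
  gt_unit : forall x : (unitc S : nilDgVect k), exists! c : k, x = c *: e;
  gt_unit_degree : piece (unitc S : nilDgVect k) 0 e;
  gt_assoc : forall (A B C : nilDgVect k) (a : A) (b : B) (c : C),
    (assoc S A B C : nilDgHom _ _) (t _ C (t A B a b) c) =
    t A _ a (t B C b c);
  gt_lunit : forall (A : nilDgVect k) (a : A),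
    (lunit S A : nilDgHom _ _) (t _ A e a) = a;
  gt_runit : forall (A : nilDgVect k) (a : A),
    (runit S A : nilDgHom _ _) (t A _ a e) = a;
  gt_braid : forall (A B : nilDgVect k) i j (a : A) (b : B),
    piece A i a -> piece B j b ->
    (braid S A B : nilDgHom _ _) (t A B a b) = koszul k (i * j) *: t B A b a
}.

(* Main.v *)
Require Import Defs.
From HB Require Import structures.
From mathcomp Require Import all_boot all_order all_algebra.
From mathcomp Require Import boolp generic_quotient.
Set Implicit Arguments.
Unset Strict Implicit.
Unset Printing Implicit Defensive.
Import GRing.Theory.
Local Open Scope ring_scope.

(**
The sign (-1)^i in d(a (x) b) = da (x) b + (-1)^i a (x) db is absorbed in the
linear operators s_n : a |-> (-1)^(n i) a (a homogeneous of degree i): the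
differential of A (x) B is d (x) 1 + s_1 (x) d, the braiding sends a (x) b to
s_i b (x) a for a of degree i, and the product of A (x) B is
(a (x) b)(a' (x) b') = a (s_j a') (x) b b' for b of degree j. Since s_n commutes
with homogeneous maps of degree 0, is multiplicative, satisfies
s_(m+n) = s_m s_n and s_n d = (-1)^n d s_n, and acts diagonally on A (x) B, the
axioms can be checked on pure tensors of homogeneous elements. A monoid structure
A (x) A -> A is a degree 0 bilinear product, and its compatibility with
differentials is the Leibniz rule.
*)

(** * Tensor products of modules *)

(** The isomorphism of categories and the strict monoidality of the forgetful functor are equalities
    of objects and arrows, not natural isomorphisms. So every algebra structure sits on the very
    object of Nil-dgvect that it enriches: the forgetful functors then agree with the constructions
    by computation, the axioms for Nil-dga are instances of those for Nil-dgvect, and what remains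
    are equalities of structures on a fixed object, settled by extensionality and proof irrelevance.
    The sign operators serve a second purpose: a condition given for homogeneous elements only, such
    as the Leibniz rule, becomes a bilinear identity valid for all elements, the form in which it
    passes through the universal property of the tensor product. *)

Section BuildLinear.
Variables (R : nzRingType) (U V W : lmodType R).

Definition linear_of (f : U -> V) (fL : linear f) : {linear U -> V} :=
  HB.pack f (GRing.isLinear.Build R U V *:%R f fL).

Definition bilinear_of (f : U -> V -> W)
    (fl : forall v, linear (f^~ v)) (fr : forall u, linear (f u)) :
    {bilinear U -> V -> W} :=
  HB.pack f (bilinear_isBilinear.Build R U V W *:%R *:%R f (fl, fr)).

End BuildLinear.

(** A bundled bilinear map carries proofs of its laws, which are equal by irrelevance. Equality of
    the bundles, beyond agreement of values, is needed to identify two algebra structures. *)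
Lemma bilinear_eq (R : nzRingType) (U V W : lmodType R)
  (f g : {bilinear U -> V -> W}) : f =2 g -> f = g.
Proof.
move=> fg; have {fg} : (f : U -> V -> W) = g by apply/funext => u; apply/funext.
case: f g => [f [[f1 f2 f3 f4]]] [g [[g1 g2 g3 g4]]] /= fg.
case: _ / fg g1 g2 g3 g4 => g1 g2 g3 g4.
by rewrite (Prop_irrelevance f1 g1) (Prop_irrelevance f2 g2)
  (Prop_irrelevance f3 g3) (Prop_irrelevance f4 g4).
Qed.

(** * The tensor product as a quotient of finite sequences of pairs *)

Section Tensor.
Local Open Scope quotient_scope.
Variables (R : comNzRingType) (V W : lmodType R).

Definition pair_sum (Z : lmodType R) (g : V -> W -> Z) (s : seq (V * W)) : Z :=
  \sum_(p <- s) g p.1 p.2.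

(* The quantification over [Z] is impredicative, so that the quotient lives   *)
(* in the universe of [V] and [W] and has the universal property by fiat.     *)
Definition tensor_rel (s1 s2 : seq (V * W)) : bool :=
  `[< forall (Z : lmodType R) (g : {bilinear V -> W -> Z}),
        pair_sum g s1 = pair_sum g s2 >].

Lemma tensor_rel_equiv : equiv_class_of tensor_rel.
Proof.
split=> [s|s1 s2|s2 s1 s3]; rewrite /tensor_rel.
- by apply/asboolP.
- by apply/idP/idP => /asboolP e; apply/asboolP => Z g; rewrite e.
- by move=> /asboolP e12 /asboolP e23; apply/asboolP => Z g; rewrite e12.
Qed.

Canonical tensor_equiv := EquivRelPack tensor_rel_equiv.

Definition tensor := {eq_quot tensor_rel}.
HB.instance Definition _ := Choice.on tensor.

Lemma tensor_eqP (s1 s2 : seq (V * W)) :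
  (forall (Z : lmodType R) (g : {bilinear V -> W -> Z}),
      pair_sum g s1 = pair_sum g s2) -> \pi_tensor s1 = \pi_tensor s2.
Proof. by move=> e; apply/eqmodP/asboolP. Qed.

(** The operations below act on chosen representatives. Since a bilinear map does not see which one
    was chosen, each module law reduces to the same law in the target [Z]. *)
Lemma pair_sum_repr (Z : lmodType R) (g : {bilinear V -> W -> Z}) s :
  pair_sum g (repr (\pi_tensor s)) = pair_sum g s.
Proof.
have /eqmodP/asboolP -> // : \pi_tensor (repr (\pi_tensor s)) = \pi_tensor s.
by rewrite reprK.
Qed.

Definition scale_pairs (c : R) (s : seq (V * W)) : seq (V * W) :=
  [seq (c *: p.1, p.2) | p <- s].

Lemma pair_sum_cat (Z : lmodType R) (g : V -> W -> Z) s1 s2 :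
  pair_sum g (s1 ++ s2) = pair_sum g s1 + pair_sum g s2.
Proof. exact: big_cat. Qed.

Lemma pair_sum_scale (Z : lmodType R) (g : {bilinear V -> W -> Z}) c s :
  pair_sum g (scale_pairs c s) = c *: pair_sum g s.
Proof.
rewrite /pair_sum big_map scaler_sumr.
by apply: eq_bigr => p _; rewrite linearZl_LR.
Qed.

Definition tensor_zero : tensor := \pi_tensor [::].
Definition tensor_add (x y : tensor) : tensor := \pi_tensor (repr x ++ repr y).
Definition tensor_scale (c : R) (x : tensor) : tensor :=
  \pi_tensor (scale_pairs c (repr x)).

Let pair_sumE := (pair_sum_cat, pair_sum_scale, pair_sum_repr).

Lemma tensor_addA : associative tensor_add.
Proof. by move=> x y z; apply: tensor_eqP => Z g; rewrite !pair_sumE addrA. Qed.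

Lemma tensor_addC : commutative tensor_add.
Proof. by move=> x y; apply: tensor_eqP => Z g; rewrite !pair_sumE addrC. Qed.

Lemma tensor_add0 : left_id tensor_zero tensor_add.
Proof.
move=> x; rewrite -[RHS]reprK; apply: tensor_eqP => Z g.
by rewrite !pair_sumE [pair_sum g [::]]big_nil add0r.
Qed.

Lemma tensor_addN : left_inverse tensor_zero (tensor_scale (-1)) tensor_add.
Proof.
move=> x; apply: tensor_eqP => Z g.
by rewrite !pair_sumE scaleN1r addNr [RHS]big_nil.
Qed.

HB.instance Definition _ :=
  GRing.isZmodule.Build tensor tensor_addA tensor_addC tensor_add0 tensor_addN.

Lemma tensor_scaleA a b x :
  tensor_scale a (tensor_scale b x) = tensor_scale (a * b) x.
Proof. by apply: tensor_eqP => Z g; rewrite !pair_sumE scalerA. Qed.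

Lemma tensor_scale1 : left_id 1 tensor_scale.
Proof.
move=> x; rewrite -[RHS]reprK; apply: tensor_eqP => Z g.
by rewrite !pair_sumE scale1r.
Qed.

Lemma tensor_scaleDr : right_distributive tensor_scale +%R.
Proof. by move=> c x y; apply: tensor_eqP => Z g; rewrite !pair_sumE scalerDr. Qed.

Lemma tensor_scaleDl x : {morph tensor_scale^~ x : a b / a + b}.
Proof. by move=> a b; apply: tensor_eqP => Z g; rewrite !pair_sumE scalerDl. Qed.

HB.instance Definition _ := GRing.Zmodule_isLmodule.Build R tensor
  tensor_scaleA tensor_scale1 tensor_scaleDr tensor_scaleDl.

Definition pure_fun (v : V) (w : W) : tensor := \pi_tensor [:: (v, w)].

Lemma pure_linearl w : linear (pure_fun^~ w).
Proof.
move=> c u v; apply: tensor_eqP => Z g.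
by rewrite !pair_sumE /pair_sum !big_seq1 /= linearPl.
Qed.

Lemma pure_linearr v : linear (pure_fun v).
Proof.
move=> c u w; apply: tensor_eqP => Z g.
by rewrite !pair_sumE /pair_sum !big_seq1 /= linearPr.
Qed.

End Tensor.

HB.lock Definition pure (R : comNzRingType) (V W : lmodType R) :
    {bilinear V -> W -> tensor V W} :=
  bilinear_of (@pure_linearl R V W) (@pure_linearr R V W).
Arguments pure {R V W}.

Section Lift.
Variables (R : comNzRingType) (V W Z : lmodType R) (g : {bilinear V -> W -> Z}).

Lemma tlift_linear : linear (fun x : tensor V W => pair_sum g (repr x)).
Proof. by move=> c x y; rewrite !(pair_sum_cat, pair_sum_scale, pair_sum_repr). Qed.

End Lift.

(** Independent of the representative because [g] is itself one of the test maps in [tensor_rel];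
    this is the existence half of the universal property. *)
HB.lock Definition tlift (R : comNzRingType) (V W Z : lmodType R)
    (g : {bilinear V -> W -> Z}) : {linear tensor V W -> Z} :=
  linear_of (tlift_linear g).
Arguments tlift {R V W Z} g.

Section TensorTheory.
Local Open Scope quotient_scope.
Variables (R : comNzRingType) (V W : lmodType R).
Local Notation tensor := (tensor V W).
Let pair_sumE := (@pair_sum_cat R V W, @pair_sum_scale R V W, @pair_sum_repr R V W).

Definition purel (w : W) : {linear V -> tensor} :=
  linear_of (f := pure^~ w) (fun c => linearPl pure w c).

Lemma purelE v w : purel w v = pure v w. Proof. by []. Qed.

Lemma tensor_pureP (x : tensor) :
  exists s : seq (V * W), x = \sum_(p <- s) pure p.1 p.2.
Proof.
rewrite -[x]reprK; elim: (repr x) => [|p s [s' IH]].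
  by exists [::]; rewrite big_nil.
exists (p :: s'); rewrite big_cons -IH pure.unlock.
by apply: tensor_eqP => Z g; rewrite !pair_sumE /pair_sum big_cons big_seq1.
Qed.

Lemma tensor_ind (P : tensor -> Prop) :
  P 0 -> (forall x y, P x -> P y -> P (x + y)) -> (forall v w, P (pure v w)) ->
  forall x, P x.
Proof.
by move=> P0 PD Pp x; have [s ->] := tensor_pureP x; elim/big_ind: _.
Qed.

Lemma tliftE (Z : lmodType R) (g : {bilinear V -> W -> Z}) v w :
  tlift g (pure v w) = g v w.
Proof. by rewrite tlift.unlock pure.unlock /= pair_sumE /pair_sum big_seq1. Qed.

Lemma tensor_ext (Z : lmodType R) (f g : {linear tensor -> Z}) :
  (forall v w, f (pure v w) = g (pure v w)) -> f =1 g.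
Proof.
move=> fg x; have [s ->] := tensor_pureP x.
by rewrite !linear_sum; apply: eq_bigr.
Qed.

End TensorTheory.

Arguments purel {R V W}.

(** * Graded vector spaces *)

Lemma sum_widen (I : eqType) (V : nmodType) (s t : seq I) (F : I -> V) :
  uniq s -> uniq t -> {subset s <= t} -> (forall i, i \notin s -> F i = 0) ->
  \sum_(i <- s) F i = \sum_(i <- t) F i.
Proof.
move=> us ut st F0; rewrite [RHS](bigID [in s]) /= [X in _ + X]big1 ?addr0 => [|//].
rewrite -[RHS]big_filter; apply: perm_big; apply: uniq_perm => //.
  exact: filter_uniq.
by move=> i; rewrite mem_filter /=; have := @st i; case: (i \in s) => // ->.
Qed.

(** Merges terms of the same degree, as the lists of degrees supplied by [piece_sum] may have
    repetitions. *)
Lemma sum_collect (I : eqType) (V : nmodType) (l : seq (I * V)) :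
  \sum_(p <- l) p.2 =
  \sum_(i <- undup (map fst l)) \sum_(p <- l | p.1 == i) p.2.
Proof.
rewrite (exchange_big_dep xpredT) //=; apply: eq_big_seq => p pl.
rewrite -big_filter (eq_filter (a2 := pred1 p.1)); last first.
  by move=> i /=; rewrite eq_sym.
by rewrite filter_pred1_uniq ?undup_uniq ?mem_undup ?map_f // big_seq1.
Qed.

Section Graded.
Variables (k : fieldType) (A : gradedVect k).

Lemma pieceD i (x y : A) : piece A i x -> piece A i y -> piece A i (x + y).
Proof. by move=> xi yi; rewrite -[x]scale1r; apply: pieceP. Qed.

Lemma pieceZ i c (x : A) : piece A i x -> piece A i (c *: x).
Proof. by move=> xi; rewrite -[c *: x]addr0; apply: pieceP => //; apply: piece0. Qed.

Lemma piece_bigsum i (I : Type) (s : seq I) (P : pred I) (u : I -> A) :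
  (forall j, P j -> piece A i (u j)) -> piece A i (\sum_(j <- s | P j) u j).
Proof.
move=> ui; elim/big_ind: _ => //; first exact: piece0.
by move=> x y; apply: pieceD.
Qed.

Definition decomposition (x : A) (s : seq int) (y : int -> A) : Prop :=
  [/\ uniq s, forall i, piece A i (y i), forall i, i \notin s -> y i = 0
    & x = \sum_(i <- s) y i].

Lemma decomposition_ex x : exists sy, decomposition x sy.1 sy.2.
Proof.
have [s [y [yP ->]]] := piece_sum x.
(* A degree repeated in [s] contributes [y i] once per occurrence, so its component is that multiple
   of [y i]. *)
pose z i := \sum_(p <- [seq (i, y i) | i <- s] | p.1 == i) p.2.
exists (undup s, z); split=> /=.
- exact: undup_uniq.
- by move=> i; rewrite /z big_map; apply: piece_bigsum => j /eqP /= <-.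
- move=> i; rewrite mem_undup => ins; rewrite /z big_map big1_seq //.
  by move=> j /andP[/eqP /= -> js]; rewrite js in ins.
- rewrite -(big_map (fun i => (i, y i)) xpredT snd) sum_collect -map_comp.
  by rewrite (eq_map (g := id)) // map_id.
Qed.

Lemma decomposition_widen x s t y :
  decomposition x s y -> uniq t -> {subset s <= t} -> decomposition x t y.
Proof.
case=> us yP y0 -> ut st; split=> // [i it|]; last exact: sum_widen.
by apply: y0; apply: contra it; apply: st.
Qed.

(** Over a common list of degrees the difference of the two families sums to 0, so [piece_free]
    kills it. Hence the components depend on [x] only, although decompositions are picked by choice
    below. *)
Lemma decomposition_uniq x s t y z i :
  decomposition x s y -> decomposition x t z -> y i = z i.
Proof.
move=> dy dz; pose r := undup (s ++ t).
have ur : uniq r by apply: undup_uniq.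
have sr : {subset s <= r} by move=> j js; rewrite mem_undup mem_cat js.
have tr : {subset t <= r} by move=> j jt; rewrite mem_undup mem_cat jt orbT.
have [_ yP y0 yE] := decomposition_widen dy ur sr.
have [_ zP z0 zE] := decomposition_widen dz ur tr.
have [ir|ir] := boolP (i \in r); last by rewrite y0 ?z0.
apply/eqP; rewrite -subr_eq0; apply/eqP.
apply: (piece_free (s := r) (y := fun i => y i - z i)) => //.
- by move=> j; rewrite -scaleN1r addrC; apply: pieceP.
- by rewrite sumrB -yE -zE subrr.
Qed.

Definition gsupp (x : A) : seq int := (sval (cid (decomposition_ex x))).1.
Definition gproj_fun i (x : A) : A := (sval (cid (decomposition_ex x))).2 i.

Lemma gprojP x : decomposition x (gsupp x) (gproj_fun^~ x).
Proof. by rewrite /gsupp /gproj_fun; case: cid. Qed.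

Lemma gproj_linear i : linear (gproj_fun i).
Proof.
move=> c x y; pose r := undup (gsupp x ++ gsupp y).
have ur : uniq r by apply: undup_uniq.
have xr : {subset gsupp x <= r} by move=> j jx; rewrite mem_undup mem_cat jx.
have yr : {subset gsupp y <= r} by move=> j jy; rewrite mem_undup mem_cat jy orbT.
have [_ xP x0 xE] := decomposition_widen (gprojP x) ur xr.
have [_ yP y0 yE] := decomposition_widen (gprojP y) ur yr.
apply: (decomposition_uniq (y := gproj_fun^~ _)
          (z := fun i => c *: gproj_fun i x + gproj_fun i y) i (gprojP _)).
split=> [|j|j jr|]; first exact: ur.
- exact: pieceP.
- by rewrite x0 // y0 // scaler0 addr0.
- by rewrite big_split -scaler_sumr /= -xE -yE.
Qed.

End Graded.

HB.lock Definition gproj (k : fieldType) (A : gradedVect k) i : {linear A -> A} :=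
  linear_of (gproj_linear (A := A) i).

Section GradedTheory.
Variables (k : fieldType) (A : gradedVect k).

Local Notation gproj := (gproj A).

Lemma gproj_decomposition x : decomposition x (gsupp x) (gproj^~ x).
Proof. rewrite gproj.unlock; exact: gprojP. Qed.

Lemma piece_gproj i x : piece A i (gproj i x).
Proof. by have [_ + _ _] := gproj_decomposition x; apply. Qed.

Lemma gproj_sum x : x = \sum_(i <- gsupp x) gproj i x.
Proof. by have [_ _ _ +] := gproj_decomposition x; apply. Qed.

Lemma gproj_piece i j x : piece A i x -> gproj j x = if i == j then x else 0.
Proof.
move=> xi; apply: (decomposition_uniq (t := [:: i])
  (z := fun j => if i == j then x else 0) j (gproj_decomposition _)).
split=> // [m|m|]; last by rewrite big_seq1 eqxx.
- by case: eqP => [<- //|_]; apply: piece0.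
- by rewrite inE eq_sym => /negPf ->.
Qed.

Section Extension.
Variables (Z : lmodType k) (f : int -> {linear A -> Z}).

Definition gext_fun (x : A) : Z := \sum_(i <- gsupp x) f i (gproj i x).

(** [gsupp] is an arbitrary choice, unrelated for [x], [y] and their sum; freedom in the list of
    degrees lets linearity be checked over one common list. *)
Lemma gext_fun_supp x s :
  uniq s -> (forall i, i \notin s -> gproj i x = 0) ->
  gext_fun x = \sum_(i <- s) f i (gproj i x).
Proof.
move=> us s0; have [ux _ x0 _] := gproj_decomposition x.
pose r := undup (gsupp x ++ s); have ur : uniq r by apply: undup_uniq.
have xr : {subset gsupp x <= r} by move=> j jx; rewrite mem_undup mem_cat jx.
have sr : {subset s <= r} by move=> j js; rewrite mem_undup mem_cat js orbT.
rewrite /gext_fun (sum_widen ux ur xr) ?(sum_widen us ur sr) // => i.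
- by move=> /s0 ->; rewrite linear0.
- by move=> /x0 x0i; rewrite (x0i : gproj i x = 0) linear0.
Qed.

Lemma gext_linear : linear gext_fun.
Proof.
move=> c x y; pose r := undup (gsupp x ++ gsupp y).
have ur : uniq r by apply: undup_uniq.
have x0 i : i \notin r -> gproj i x = 0.
  rewrite mem_undup mem_cat negb_or => /andP[ix _].
  by have [_ _ + _] := gproj_decomposition x; apply.
have y0 i : i \notin r -> gproj i y = 0.
  rewrite mem_undup mem_cat negb_or => /andP[_ iy].
  by have [_ _ + _] := gproj_decomposition y; apply.
rewrite !(@gext_fun_supp _ r) //; last first.
  by move=> i ir; rewrite linearP x0 // y0 // scaler0 addr0.
by rewrite scaler_sumr -big_split; apply: eq_bigr => i _; rewrite !linearP.
Qed.

End Extension.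

End GradedTheory.

(** One linear map per degree induces a map on the direct sum. The sign operators, the projections
    of a tensor product and the braiding all arise this way. *)
HB.lock Definition gext (k : fieldType) (A : gradedVect k) (Z : lmodType k)
    (f : int -> {linear A -> Z}) : {linear A -> Z} :=
  linear_of (gext_linear f).

Section GradedTheory.
Variables (k : fieldType) (A : gradedVect k).

Section Extension.
Variables (Z : lmodType k) (f : int -> {linear A -> Z}).


Lemma gext_sum x : gext f x = \sum_(i <- gsupp x) f i (gproj A i x).
Proof. by rewrite gext.unlock. Qed.

Lemma gextE i x : piece A i x -> gext f x = f i x.
Proof.
move=> xi; rewrite gext.unlock /= (@gext_fun_supp _ _ _ _ _ [:: i]) //.
  by rewrite big_seq1 (gproj_piece _ xi) eqxx.
by move=> j; rewrite inE (gproj_piece _ xi) eq_sym => /negPf ->.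
Qed.

End Extension.

Lemma graded_ext (Z : lmodType k) (f g : {linear A -> Z}) :
  (forall i x, piece A i x -> f x = g x) -> f =1 g.
Proof.
move=> fg x; rewrite (gproj_sum x) !linear_sum; apply: eq_bigr => i _.
exact/fg/piece_gproj.
Qed.

Lemma graded_ind (P : A -> Prop) :
  P 0 -> (forall x y, P x -> P y -> P (x + y)) ->
  (forall i x, piece A i x -> P x) -> forall x, P x.
Proof.
move=> P0 PD Pp x; rewrite (gproj_sum x); elim/big_ind: _ => // i _.
exact: Pp (piece_gproj i x).
Qed.

Lemma koszulD m n : koszul k (m + n) = koszul k m * koszul k n.
Proof. by rewrite /koszul expfzDr // oppr_eq0 oner_eq0. Qed.

Lemma koszul_sqr n : koszul k n * koszul k n = 1.
Proof. by rewrite /koszul -expfzMl mulrNN mulr1 exp1rz. Qed.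

Lemma koszul0 : koszul k 0 = 1. Proof. by []. Qed.

Definition gsign (n : int) : {linear A -> A} :=
  gext (fun i => koszul k (n * i) \*: idfun).

Lemma gsignE n i x : piece A i x -> gsign n x = koszul k (n * i) *: x.
Proof. by move=> xi; rewrite /gsign (gextE _ xi). Qed.

End GradedTheory.

Section GradedOfProj.
Variables (k : fieldType) (T : lmodType k) (P : int -> T -> Prop).
Variable pr : int -> {linear T -> T}.
Hypothesis P0 : forall i, P i 0.
Hypothesis PP : forall i (c : k) (x y : T), P i x -> P i y -> P i (c *: x + y).
Hypothesis Pgen : forall x, exists l : seq (int * T),
  (forall p, p \in l -> P p.1 p.2) /\ x = \sum_(p <- l) p.2.
Hypothesis prP : forall i j x, P i x -> pr j x = if i == j then x else 0.

Lemma sum_of_proj x : exists (s : seq int) (y : int -> T),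
  (forall i, P i (y i)) /\ x = \sum_(i <- s) y i.
Proof.
have [l [lP ->]] := Pgen x; rewrite sum_collect.
exists (undup (map fst l)), (fun i => \sum_(p <- l | p.1 == i) p.2); split=> // i.
rewrite big_seq_cond; elim/big_ind: _ => //.
  by move=> u v ui vi; rewrite -[u]scale1r; apply: PP.
by move=> p /andP[/lP pP /eqP <-].
Qed.

(** Applying [pr i] to a vanishing sum isolates its [i]-th term. Linear projections thus give
    directness without any analysis of the relations between tensors. *)
Lemma free_of_proj (s : seq int) (y : int -> T) : 
  uniq s -> (forall i, P i (y i)) -> \sum_(i <- s) y i = 0 ->
  forall i, i \in s -> y i = 0.
Proof.
move=> us yP y0 i si; rewrite -(linear0 (pr i)) -y0 linear_sum (bigD1_seq i) //=.
rewrite (prP _ (yP i)) eqxx big1 ?addr0 // => j /negPf ji.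
by rewrite (prP _ (yP j)) ji.
Qed.

Definition graded_of_proj : gradedVect k :=
  GradedVect P0 PP sum_of_proj free_of_proj.

End GradedOfProj.


(** * The graded tensor product *)

Section TensorGraded.
Variables (k : fieldType) (A B : gradedVect k).
Local Notation T := (tensor A B).

Lemma tensor_hext (Z : lmodType k) (f g : {linear T -> Z}) :
  (forall i j a b, piece A i a -> piece B j b -> f (pure a b) = g (pure a b)) ->
  f =1 g.
Proof.
move=> fg; apply: tensor_ext => v w.
rewrite (gproj_sum v) linear_sumlz !linear_sum; apply: eq_bigr => i _.
rewrite (gproj_sum w) linear_sumr !linear_sum; apply: eq_bigr => j _.
apply: fg; exact: piece_gproj.
Qed.

Definition tpiece (n : int) (x : T) : Prop :=
  exists s : seq (A * B), (forall p, p \in s -> exists i j,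
    [/\ i + j = n, piece A i p.1 & piece B j p.2]) /\
  x = \sum_(p <- s) pure p.1 p.2.

Lemma tpiece0 i : tpiece i 0.
Proof. by exists [::]; rewrite big_nil. Qed.

Lemma tpieceP i c x y : tpiece i x -> tpiece i y -> tpiece i (c *: x + y).
Proof.
move=> [s [sP ->]] [t [tP ->]]; exists ([seq (c *: p.1, p.2) | p <- s] ++ t); split.
  move=> p; rewrite mem_cat => /orP[/mapP[q /sP [m [n [mn q1 q2]]] -> /=]|/tP //].
  by exists m, n; split=> //; apply: pieceZ.
rewrite big_cat big_map scaler_sumr; congr (_ + _).
by apply: eq_bigr => p _; rewrite linearZl_LR.
Qed.

Lemma tpiece_pure i j a b : piece A i a -> piece B j b -> tpiece (i + j) (pure a b).
Proof.
move=> ai bj; exists [:: (a, b)]; rewrite big_seq1; split=> // p.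
by rewrite inE => /eqP -> ; exists i, j.
Qed.

Lemma tpiece_ind i (P : T -> Prop) :
  P 0 -> (forall x y, P x -> P y -> P (x + y)) ->
  (forall m n a b, m + n = i -> piece A m a -> piece B n b -> P (pure a b)) ->
  forall x, tpiece i x -> P x.
Proof.
move=> P0 PD Pp x [s [sP ->]]; rewrite big_seq; elim/big_ind: _ => // p.
by move=> /sP[m [n [mn pm pn]]]; apply: Pp mn pm pn.
Qed.

(** The component of total degree n, that is, the sum over i of a_i (x) b_(n-i), finite because a
    has finitely many components. *)
Definition tproj_pure n (a : A) (b : B) : T :=
  gext (fun i => purel (gproj B (n - i) b)) a.

Lemma tproj_linearl n b : linear (tproj_pure n ^~ b).
Proof. exact: linearP. Qed.

Lemma tproj_linearr n a : linear (tproj_pure n a).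
Proof.
move=> c x y; rewrite /tproj_pure !gext_sum scaler_sumr -big_split.
by apply: eq_bigr => i _; rewrite !purelE linearP linearPr.
Qed.

Definition tproj n : {linear T -> T} :=
  tlift (bilinear_of (@tproj_linearl n) (@tproj_linearr n)).

Lemma tproj_piece i j x : tpiece i x -> tproj j x = if i == j then x else 0.
Proof.
move: x; apply: tpiece_ind => [|x y|m n a b <- am bn].
- by rewrite linear0 if_same.
- by rewrite linearD => -> ->; case: eqP; rewrite ?addr0.
rewrite tliftE [LHS](gextE _ am) purelE.
rewrite (gproj_piece _ bn) [n == _]eq_sym subr_eq eq_sym [n + m]addrC.
by case: eqP => // _; rewrite linear0r.
Qed.

Lemma tpiece_gen x : exists l : seq (int * T),
  (forall p, p \in l -> tpiece p.1 p.2) /\ x = \sum_(p <- l) p.2.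
Proof.
have [s ->] := tensor_pureP x.
elim: s => [|p s [l [lP lE]]]; first by exists [::]; rewrite !big_nil.
exists ([seq (i + j, pure (gproj A i p.1) (gproj B j p.2)) |
         i <- gsupp p.1, j <- gsupp p.2] ++ l); split.
  move=> q; rewrite mem_cat => /orP[/allpairsP[[i j] /= [_ _ ->]] /=|/lP //].
  exact: tpiece_pure (piece_gproj _ _) (piece_gproj _ _).
rewrite big_cons lE big_cat; congr (_ + _).
rewrite big_allpairs_dep {1}(gproj_sum p.1) linear_sumlz; apply: eq_bigr => i _.
by rewrite {1}(gproj_sum p.2) linear_sumr.
Qed.

Definition tensor_graded : gradedVect k :=
  graded_of_proj tpiece0 tpieceP tpiece_gen tproj_piece.

End TensorGraded.

Lemma gsign_tensor (k : fieldType) (A B : gradedVect k) n (a : A) (b : B) :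
  gsign (tensor_graded A B) n (pure a b) = pure (gsign A n a) (gsign B n b).
Proof.
(* The operator s_n (x) s_n as a linear map, so that the comparison can be made on homogeneous pure
   tensors, where both sides carry the sign (-1)^(n (i + j)). *)
pose f : {linear tensor A B -> tensor A B} :=
  tlift (bilinear_of (f := fun a b => pure (gsign A n a) (gsign B n b))
    (fun b c u v => etrans (congr1 (pure^~ _) (linearP _ _ _ _)) (linearPl _ _ _ _ _))
    (fun a c u v => etrans (congr1 (pure _) (linearP _ _ _ _)) (linearPr _ _ _ _ _))).
transitivity (f (pure a b)); last by rewrite tliftE.
apply: (tensor_hext (f := gsign (tensor_graded A B) n)) => i j {}a {}b ai bj.
rewrite tliftE /= (gsignE _ ai) (gsignE _ bj) linearZr_LR linearZl_LR /=.
rewrite (@gsignE _ (tensor_graded A B) _ (i + j)); last exact: tpiece_pure.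
by rewrite scalerA -koszulD -mulrDr addrC.
Qed.

Lemma iter_linear0 (R : nzRingType) (V : lmodType R) (f : {linear V -> V}) n :
  iter n f 0 = 0.
Proof. by elim: n => //= n ->; rewrite linear0. Qed.

Lemma iter_linearP (R : nzRingType) (V : lmodType R) (f : {linear V -> V}) n c x y :
  iter n f (c *: x + y) = c *: iter n f x + iter n f y.
Proof. by elim: n => //= n ->; rewrite linearP. Qed.

(** * Commutation rules for the sign operators *)

Section Signs.
Variables (k : fieldType) (A : nilDgVect k).

Lemma gsign_diff n (a : A) :
  diff A (gsign A n a) = koszul k n *: gsign A n (diff A a).
Proof.
apply: (graded_ext (f := diff A \o gsign A n)
                   (g := koszul k n \*: (gsign A n \o diff A))) => i x xi /=.
rewrite (gsignE _ xi) (gsignE _ (diff_degree xi)) linearZ scalerA -koszulD.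
by rewrite mulrDr mulr1 addrCA koszulD [koszul k (n + n)]koszulD koszul_sqr mulr1.
Qed.

(** Moving s_n inside an iterated differential only costs signs, which go into [a']. In the
    nilpotency argument this keeps the left factor an i-fold differential. *)
Lemma gsign_iter_diff n i (a : A) : exists a',
  gsign A n (iter i (diff A) a) = iter i (diff A) a'.
Proof.
elim: i => [|i [a' IH]]; first by exists (gsign A n a).
exists (koszul k n *: a'); rewrite -[koszul k n *: a']addr0 iter_linearP.
rewrite iter_linear0 addr0 /= -IH gsign_diff scalerA koszul_sqr.
by rewrite scale1r.
Qed.

Lemma gsignD m n (a : A) : gsign A (m + n) a = gsign A m (gsign A n a).
Proof.
apply: (graded_ext (f := gsign A (m + n)) (g := gsign A m \o gsign A n)) => i x xi.
by rewrite /= !(gsignE _ xi) linearZ /= (gsignE _ xi) scalerA -koszulD mulrDl addrC.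
Qed.

Lemma gsign_hom (B : nilDgVect k) (f : nilDgHom A B) n a :
  f (gsign A n a) = gsign B n (f a).
Proof.
apply: (graded_ext (f := f \o gsign A n) (g := gsign B n \o f)) => i x xi.
have fxi : piece B i (f x) by rewrite -[i]addr0; apply: nd_fun_degree.
by rewrite /= (gsignE _ xi) (gsignE _ fxi) linearZ.
Qed.

End Signs.

(** * The differential of a tensor product and its nilpotency *)

Section TensorDg.
Variables (k : fieldType) (A B : nilDgVect k).

Definition tdiff_pure (a : A) (b : B) : tensor A B :=
  pure (diff A a) b + pure (gsign A 1 a) (diff B b).

Lemma tdiff_linearl b : linear (tdiff_pure ^~ b).
Proof.
move=> c u v; rewrite /tdiff_pure !linearP !linearPl /= scalerDr.
by rewrite addrACA.
Qed.

Lemma tdiff_linearr a : linear (tdiff_pure a).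
Proof.
move=> c u v; rewrite /tdiff_pure !linearP /= scalerDr.
by rewrite addrACA.
Qed.

Definition tdiff : {linear tensor_graded A B -> tensor_graded A B} :=
  tlift (bilinear_of tdiff_linearl tdiff_linearr).

Lemma tdiffE a b :
  tdiff (pure a b) = pure (diff A a) b + pure (gsign A 1 a) (diff B b).
Proof. exact: tliftE. Qed.

Lemma tdiff_degree : of_degree 1 tdiff.
Proof.
move=> i x; move: x; apply: tpiece_ind => [|x y|m n a b <- am bn].
- by rewrite linear0; apply: piece0.
- by rewrite linearD; apply: pieceD.
rewrite tdiffE (gsignE _ am) linearZl_LR.
apply: (@pieceD _ (tensor_graded A B)).
  by rewrite addrAC; apply: tpiece_pure => //; apply: diff_degree.
apply: (@pieceZ _ (tensor_graded A B)).
by rewrite -addrA; apply: tpiece_pure => //; apply: diff_degree.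
Qed.

(** The summands d (x) 1 and s_1 (x) d anticommute, so powers of their sum have signed binomial
    coefficients; the induction avoids them by counting only. Each application to d^i a (x) d^j b
    raises i or j by one, and once i + j >= M + N one of the two factors vanishes. *)
Lemma tdiff_nilp : exists N : nat, (2 <= N)%N /\ forall x, iter N tdiff x = 0.
Proof.
have [M [M2 dM]] := diff_nilp A; have [N [N2 dN]] := diff_nilp B.
(* M + N - 1 would suffice. *)
exists (M + N)%N; split; first exact: leq_trans M2 (leq_addr _ _).
have vanish (C : nilDgVect k) K x i :
    (forall x, iter K (diff C) x = 0) -> (K <= i)%N -> iter i (diff C) x = 0.
  by move=> dK /subnK <-; rewrite iterD dK iter_linear0.
have main p : forall i j a b, (M + N <= i + j + p)%N ->
    iter p tdiff (pure (iter i (diff A) a) (iter j (diff B) b)) = 0.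
  elim: p => [|p IH] i j a b; rewrite ?addn0 => ijp.
    have [Mi|iM] := leqP M i; first by rewrite (vanish _ M) // linear0l.
    rewrite (vanish _ N _ j) ?linear0r //.
    by rewrite -(leq_add2l M) (leq_trans ijp) // leq_add2r ltnW.
  (* The factor 1 brings the sum into the form required by [iter_linearP]. *)
  rewrite iterSr tdiffE -[X in iter _ _ X]scale1r scalerDr iter_linearP scale1r.
  rewrite -!iterS IH ?scaler0 ?add0r; last by rewrite !addSn -addnS.
  by have [a' ->] := gsign_iter_diff 1 i a; rewrite IH // addnS addSn -addnS.
move=> x; move: x; apply: tensor_ind => [|x y x0 y0|a b].
- exact: iter_linear0.
- by rewrite -[x]scale1r iter_linearP x0 y0 scaler0 addr0.
- exact: (main _ 0 0 a b).
Qed.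

Definition tensor_dg : nilDgVect k := NilDgVect tdiff_degree tdiff_nilp.

End TensorDg.

Section TensorHom.
Variables (k : fieldType) (A B Z : nilDgVect k) (g : {bilinear A -> B -> Z}).
Hypothesis g_degree : forall i j a b,
  piece A i a -> piece B j b -> piece Z (i + j) (g a b).
Hypothesis g_diff : forall a b,
  diff Z (g a b) = g (diff A a) b + g (gsign A 1 a) (diff B b).

Lemma tensor_lift_degree :
  @of_degree k 0 (tensor_dg A B) Z (tlift g).
Proof.
move=> i x; rewrite addr0; move: x.
apply: tpiece_ind => [|x y|m n a b <- am bn].
- by rewrite linear0; apply: piece0.
- by rewrite linearD; apply: pieceD.
by rewrite tliftE; apply: g_degree.
Qed.

Lemma tensor_lift_diff x : diff Z (tlift g x) = tlift g (diff (tensor_dg A B) x).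
Proof.
apply: (tensor_ext (f := diff Z \o tlift g) (g := tlift g \o tdiff A B)) => a b /=.
by rewrite tdiffE linearD !tliftE.
Qed.

End TensorHom.

(** The universal property inside Nil-dgvect, with the Leibniz rule in operator form. The structure
    morphisms and products constructed below are instances of it or composites of instances. *)
HB.lock Definition tensor_lift (k : fieldType) (A B Z : nilDgVect k)
    (g : {bilinear A -> B -> Z})
    (g_degree : forall i j a b,
       piece A i a -> piece B j b -> piece Z (i + j) (g a b))
    (g_diff : forall a b,
       diff Z (g a b) = g (diff A a) b + g (gsign A 1 a) (diff B b)) :
    nilDgHom (tensor_dg A B) Z :=
  NilDgHom (tensor_lift_degree g_degree) (tensor_lift_diff g_diff).

Lemma tensor_liftE (k : fieldType) (A B Z : nilDgVect k)
    (g : {bilinear A -> B -> Z}) g_degree g_diff a b :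
  @tensor_lift k A B Z g g_degree g_diff (pure a b) = g a b.
Proof. by rewrite tensor_lift.unlock; apply: tliftE. Qed.

Section HomExt.
Variable k : fieldType.
Implicit Types A B C D Z : nilDgVect k.
Local Notation "A ⊗ B" := (tensor_dg A B) (at level 40, left associativity).

Lemma tensor_hom_ext A B Z (f g : nilDgHom (A ⊗ B) Z) :
  (forall a b, f (pure a b) = g (pure a b)) -> f = g.
Proof. by move=> fg; apply: nilDgHom_eq; apply: tensor_ext. Qed.

Lemma tensor_hom_hext A B Z (f g : nilDgHom (A ⊗ B) Z) :
  (forall i j a b, piece A i a -> piece B j b -> f (pure a b) = g (pure a b)) ->
  f = g.
Proof. by move=> fg; apply: nilDgHom_eq; apply: tensor_hext. Qed.

Lemma tensor_hom_ext3 A B C Z (f g : nilDgHom (A ⊗ B ⊗ C) Z) :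
  (forall a b c, f (pure (pure a b) c) = g (pure (pure a b) c)) -> f = g.
Proof.
move=> fg; apply: tensor_hom_ext => x c.
apply: (tensor_ext (f := f \o @purel _ (A ⊗ B) C c) (g := g \o @purel _ (A ⊗ B) C c)).
by move=> a b; apply: fg.
Qed.

Lemma tensor_hom_hext3 A B C Z (f g : nilDgHom (A ⊗ B ⊗ C) Z) :
  (forall i j l a b c, piece A i a -> piece B j b -> piece C l c ->
     f (pure (pure a b) c) = g (pure (pure a b) c)) -> f = g.
Proof.
move=> fg; apply: tensor_hom_ext => x c.
apply: (tensor_hext (f := f \o @purel _ (A ⊗ B) C c) (g := g \o @purel _ (A ⊗ B) C c)).
move=> i j a b ai bj.
apply: (graded_ext (f := f \o @pure _ (A ⊗ B) C (pure a b))
                   (g := g \o @pure _ (A ⊗ B) C (pure a b))).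
by move=> l {}c cl; apply: fg ai bj cl.
Qed.

Lemma tensor_hom_ext4 A B C D Z (f g : nilDgHom (A ⊗ B ⊗ C ⊗ D) Z) :
  (forall a b c d,
     f (pure (pure (pure a b) c) d) = g (pure (pure (pure a b) c) d)) -> f = g.
Proof.
move=> fg; apply: tensor_hom_ext3 => x c d.
apply: (tensor_ext
  (f := f \o @purel _ (A ⊗ B ⊗ C) D d \o @purel _ (A ⊗ B) C c)
  (g := g \o @purel _ (A ⊗ B ⊗ C) D d \o @purel _ (A ⊗ B) C c)).
by move=> a b; apply: fg.
Qed.

Lemma nd_fun_piece A B (f : nilDgHom A B) i a : piece A i a -> piece B i (f a).
Proof. by rewrite -{2}[i]addr0; apply: nd_fun_degree. Qed.

End HomExt.

(** * Associator, unit object, unitors and braiding *)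

Section Structure.
Variable k : fieldType.
Implicit Types A B C D Z : nilDgVect k.
Local Notation "A ⊗ B" := (tensor_dg A B) (at level 40, left associativity).

Section TensorMap.
Variables (A B A' B' : nilDgVect k) (f : nilDgHom A A') (g : nilDgHom B B').

Lemma tensor_map_linearl b : linear (fun a => pure (f a) (g b)).
Proof. by move=> c u v; rewrite linearP linearPl. Qed.

Lemma tensor_map_linearr a : linear (fun b => pure (f a) (g b)).
Proof. by move=> c u v; rewrite linearP linearPr. Qed.

Definition tensor_map : nilDgHom (A ⊗ B) (A' ⊗ B').
Proof.
apply: (@tensor_lift _ A B (A' ⊗ B') (bilinear_of tensor_map_linearl tensor_map_linearr)).
- by move=> i j a b ai bj /=; apply: tpiece_pure; apply: nd_fun_piece.
- by move=> a b /=; rewrite tdiffE !nd_fun_diff gsign_hom.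
Defined.

Lemma tensor_mapE a b : tensor_map (pure a b) = pure (f a) (g b).
Proof. exact: tensor_liftE. Qed.

End TensorMap.

Section Associator.
Variables A B C : nilDgVect k.

Lemma assoc_pure_linearl c b : linear (fun a : A => pure a (pure (b : B) (c : C))).
Proof. by move=> e u v; rewrite linearPl. Qed.

Lemma assoc_pure_linearr c a : linear (fun b : B => pure (a : A) (pure b (c : C))).
Proof. by move=> e u v; rewrite linearPl linearPr. Qed.

(** Two nested lifts: with [c] fixed, the map is lifted from pairs (a, b), and the result is lifted
    again as a bilinear map in [x] and [c]. *)
Definition assoc_fun (x : A ⊗ B) (c : C) : A ⊗ (B ⊗ C) :=
  tlift (bilinear_of (assoc_pure_linearl c) (assoc_pure_linearr c)) x.

Lemma assoc_funE a b c : assoc_fun (pure a b) c = pure a (pure b c).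
Proof. exact: tliftE. Qed.

Lemma assoc_linearl c : linear (assoc_fun ^~ c).
Proof. exact: linearP. Qed.

Lemma assoc_linearr x : linear (assoc_fun x).
Proof.
move=> e u v; elim/tensor_ind: x => [|x y xP yP|a b].
- by rewrite /assoc_fun !linear0 add0r.
- by rewrite /assoc_fun !linearD -!/(assoc_fun _ _) xP yP addrACA.
- by rewrite !assoc_funE !linearPr.
Qed.

Definition assoc_hom : nilDgHom (A ⊗ B ⊗ C) (A ⊗ (B ⊗ C)).
Proof.
apply: (@tensor_lift _ (A ⊗ B) C (A ⊗ (B ⊗ C)) (bilinear_of assoc_linearl assoc_linearr)).
- move=> i j x c xi cj /=; move: x xi.
  apply: tpiece_ind => [|x y|m n a b <- am bn].
  + by rewrite /assoc_fun linear0; apply: (@piece0 _ (A ⊗ (B ⊗ C))).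
  + by rewrite /assoc_fun linearD; apply: (@pieceD _ (A ⊗ (B ⊗ C))).
  + by rewrite assoc_funE -addrA; do 2!apply: tpiece_pure => //.
- move=> x c /=; elim/tensor_ind: x => [|x y xP yP|a b].
  + by rewrite /assoc_fun !linear0 addr0.
  + by rewrite /assoc_fun !linearD -!/(assoc_fun _ _) xP yP addrACA.
  (* As s_1 acts diagonally on A (x) B, both sides expand to da (x) b (x) c + s_1 a (x) db (x) c +
     s_1 a (x) s_1 b (x) dc. *)
  rewrite assoc_funE !tdiffE gsign_tensor assoc_funE linearDr.
  by rewrite /assoc_fun linearD -!/(assoc_fun _ _) !assoc_funE addrA.
Defined.

Lemma assoc_homE a b c : assoc_hom (pure (pure a b) c) = pure a (pure b c).
Proof. by rewrite [LHS]tensor_liftE /= assoc_funE. Qed.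

Lemma assoc_inv_linearl (a : A) (c : C) : linear (fun b : B => pure (pure a b) c).
Proof. by move=> e u v; rewrite linearPr linearPl. Qed.

Lemma assoc_inv_linearr (a : A) (b : B) : linear (fun c : C => pure (pure a b) c).
Proof. by move=> e u v; rewrite linearPr. Qed.

Definition assoc_inv_fun (a : A) (y : B ⊗ C) : A ⊗ B ⊗ C :=
  tlift (bilinear_of (assoc_inv_linearl a) (assoc_inv_linearr a)) y.

Lemma assoc_inv_funE a b c : assoc_inv_fun a (pure b c) = pure (pure a b) c.
Proof. exact: tliftE. Qed.

Lemma assoc_inv_fun_linearr a : linear (assoc_inv_fun a).
Proof. exact: linearP. Qed.

Lemma assoc_inv_fun_linearl y : linear (assoc_inv_fun ^~ y).
Proof.
move=> e u v; elim/tensor_ind: y => [|x y xP yP|b c].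
- by rewrite /assoc_inv_fun !linear0 add0r.
- by rewrite /assoc_inv_fun !linearD -!/(assoc_inv_fun _ _) xP yP addrACA.
- by rewrite !assoc_inv_funE !linearPl.
Qed.

Definition assoc_inv : nilDgHom (A ⊗ (B ⊗ C)) (A ⊗ B ⊗ C).
Proof.
apply: (@tensor_lift _ A (B ⊗ C) (A ⊗ B ⊗ C)
          (bilinear_of assoc_inv_fun_linearl assoc_inv_fun_linearr)).
- move=> i j a y ai yj /=; move: y yj.
  apply: tpiece_ind => [|x y|m n b c <- bm cn].
  + by rewrite /assoc_inv_fun linear0; apply: (@piece0 _ (A ⊗ B ⊗ C)).
  + by rewrite /assoc_inv_fun linearD; apply: (@pieceD _ (A ⊗ B ⊗ C)).
  + by rewrite assoc_inv_funE addrA; do 2!apply: tpiece_pure => //.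
- move=> a y /=; elim/tensor_ind: y => [|x y xP yP|b c].
  + by rewrite /assoc_inv_fun !linear0 addr0.
  + by rewrite /assoc_inv_fun !linearD -!/(assoc_inv_fun _ _) xP yP addrACA.
  rewrite assoc_inv_funE !tdiffE gsign_tensor assoc_inv_funE linearDl.
  by rewrite /assoc_inv_fun linearD -!/(assoc_inv_fun _ _) !assoc_inv_funE addrA.
Defined.

Lemma assoc_invE a b c : assoc_inv (pure a (pure b c)) = pure (pure a b) c.
Proof. by rewrite [LHS]tensor_liftE /= assoc_inv_funE. Qed.

End Associator.

Section Unit.

Definition unit_piece (i : int) (x : k^o) : Prop := i != 0 -> x = 0.

Lemma unit_piece0 i : unit_piece i 0. Proof. by []. Qed.

Lemma unit_pieceP i c x y :
  unit_piece i x -> unit_piece i y -> unit_piece i (c *: x + y).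
Proof. by move=> xi yi i0; rewrite xi // yi // scaler0 addr0. Qed.

Lemma unit_gen (x : k^o) : exists l : seq (int * k^o),
  (forall p, p \in l -> unit_piece p.1 p.2) /\ x = \sum_(p <- l) p.2.
Proof.
exists [:: (0, x)]; rewrite big_seq1; split=> // p.
by rewrite inE => /eqP -> /=; rewrite /unit_piece eqxx.
Qed.

Definition unit_proj (i : int) : {linear k^o -> k^o} :=
  if i == 0 then (idfun : {linear k^o -> k^o}) else (\0 : {linear k^o -> k^o}).

Lemma unit_projP i j (x : k^o) :
  unit_piece i x -> unit_proj j x = if i == j then x else 0.
Proof.
rewrite /unit_piece /unit_proj; have [-> _|i0 -> //] := eqVneq i 0.
  by rewrite eq_sym; case: eqP.
by rewrite if_same; case: eqP.
Qed.

Definition unit_graded : gradedVect k :=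
  graded_of_proj unit_piece0 unit_pieceP unit_gen unit_projP.

Lemma unit_diff_degree : @of_degree k 1 unit_graded unit_graded \0.
Proof. by move=> i x _; apply: piece0. Qed.

Lemma unit_diff_nilp : exists N : nat, (2 <= N)%N /\
  forall x : unit_graded, iter N (\0 : {linear unit_graded -> unit_graded}) x = 0.
Proof. by exists 2. Qed.

Definition unit_dg : nilDgVect k := NilDgVect unit_diff_degree unit_diff_nilp.

Lemma unit_dgE (x : unit_dg) : x = (x : k) *: (1 : k^o).
Proof. by rewrite /GRing.scale /= mulr1. Qed.

End Unit.

Section Unitors.
Variable A : nilDgVect k.

Lemma lunit_linearl (a : A) : linear (fun c : unit_dg => (c : k) *: a).
Proof. by move=> e u v /=; rewrite scalerDl scalerA. Qed.

Lemma lunit_linearr (c : unit_dg) : linear (fun a : A => (c : k) *: a).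
Proof. by move=> e u v /=; rewrite scalerDr !scalerA mulrC. Qed.

Definition lunit_hom : nilDgHom (unit_dg ⊗ A) A.
Proof.
apply: (@tensor_lift _ unit_dg A A (bilinear_of lunit_linearl lunit_linearr)).
- move=> i j c a ci aj /=; have [->|i0] := eqVneq i 0.
    by rewrite add0r; apply: pieceZ.
  by rewrite (ci i0) scale0r; apply: piece0.
- move=> c a /=; rewrite linearZ /= scale0r add0r; congr (_ *: _).
  (* The whole unit object lies in degree 0, so s_1 fixes it. *)
  have c0 : piece unit_dg 0 c by [].
  by rewrite (gsignE _ c0) mulr0 koszul0 scale1r.
Defined.

Lemma lunit_homE c a : lunit_hom (pure c a) = (c : k) *: a.
Proof. exact: tensor_liftE. Qed.



Definition runit_hom : nilDgHom (A ⊗ unit_dg) A.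
Proof.
pose g : {bilinear A -> unit_dg -> A} :=
  bilinear_of (f := fun (a : A) (c : unit_dg) => (c : k) *: a)
    lunit_linearr lunit_linearl.
apply: (@tensor_lift _ A unit_dg A g).
- move=> i j a c ai cj /=; have [->|j0] := eqVneq j 0.
    by rewrite addr0; apply: pieceZ.
  by rewrite (cj j0) scale0r; apply: piece0.
- by move=> a c /=; rewrite linearZ /= scale0r addr0.
Defined.

Lemma runit_homE c a : runit_hom (pure a c) = (c : k) *: a.
Proof. exact: tensor_liftE. Qed.

End Unitors.

Section Braiding.
Variables A B : nilDgVect k.

Definition braid_fun (a : A) (b : B) : B ⊗ A :=
  gext (fun i => @pure _ B A (gsign B i b)) a.

Lemma braid_funE i a b : piece A i a -> braid_fun a b = pure (gsign B i b) a.
Proof. by move=> ai; rewrite /braid_fun (gextE _ ai). Qed.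

Lemma braid_linearl b : linear (braid_fun ^~ b).
Proof. exact: linearP. Qed.

Lemma braid_linearr a : linear (braid_fun a).
Proof.
move=> c u v; rewrite /braid_fun !gext_sum scaler_sumr -big_split.
by apply: eq_bigr => i _ /=; rewrite linearP linearPl.
Qed.

Definition braid_hom : nilDgHom (A ⊗ B) (B ⊗ A).
Proof.
apply: (@tensor_lift _ A B (B ⊗ A) (bilinear_of braid_linearl braid_linearr)).
- move=> i j a b ai bj /=; rewrite (braid_funE _ ai) (gsignE _ bj) linearZl_LR.
  by rewrite addrC; apply: (@pieceZ _ (B ⊗ A)); apply: tpiece_pure.
- move=> a b /=; elim/graded_ind: a => [|x y xP yP|i a ai].
  + by rewrite /braid_fun !linear0 addr0.
  + by rewrite /braid_fun !linearD -!/(braid_fun _ _) xP yP addrACA.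
  (* The terms in da match by s_(i+1) = s_1 s_i, and those in db by d s_i = (-1)^i s_i d, the scalar
     (-1)^i coming from s_1 a. *)
  rewrite (braid_funE _ ai) (gsignE _ ai) tdiffE (braid_funE _ (diff_degree ai)).
  rewrite /braid_fun linearZ -/(braid_fun _ _) (braid_funE _ ai) addrC.
  by rewrite [i + 1]addrC gsignD gsign_diff linearZl_LR mul1r.
Defined.

Lemma braid_homE i a b : piece A i a -> braid_hom (pure a b) = pure (gsign B i b) a.
Proof. by move=> ai; rewrite [LHS]tensor_liftE /= (braid_funE _ ai). Qed.

End Braiding.

End Structure.

(** * The symmetric monoidal category *)

Section UnitorInverses.
Variables (k : fieldType) (A : nilDgVect k).

Lemma lunit_inv_degree :
  @of_degree k 0 A (tensor_dg (unit_dg k) A) (pure (1 : unit_dg k)).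
Proof.
by move=> i a ai; rewrite addr0 -[i]add0r; apply: tpiece_pure.
Qed.

Lemma lunit_inv_diff (a : A) :
  diff (tensor_dg (unit_dg k) A) (pure (1 : unit_dg k) a) =
  pure (1 : unit_dg k) (diff A a).
Proof.
rewrite tdiffE /= linear0l add0r.
have p1 : piece (unit_dg k) 0 1 by [].
by rewrite (gsignE _ p1) mulr0 koszul0 scale1r.
Qed.

Definition lunit_inv : nilDgHom A (tensor_dg (unit_dg k) A) :=
  NilDgHom lunit_inv_degree lunit_inv_diff.

Lemma runit_inv_degree :
  @of_degree k 0 A (tensor_dg A (unit_dg k)) (@purel _ A (unit_dg k) 1).
Proof. by move=> i a ai; apply: tpiece_pure. Qed.

Lemma runit_inv_diff (a : A) :
  diff (tensor_dg A (unit_dg k)) (@purel _ A (unit_dg k) 1 a) =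
  @purel _ A (unit_dg k) 1 (diff A a).
Proof. by rewrite !purelE tdiffE /= linear0r addr0. Qed.

Definition runit_inv : nilDgHom A (tensor_dg A (unit_dg k)) :=
  NilDgHom runit_inv_degree runit_inv_diff.

End UnitorInverses.

Section Monoidal.
Variable k : fieldType.
Local Notation NDG := (NilDgVectCat k).
Local Open Scope cat_scope.
Local Obligation Tactic := idtac.

Lemma assoc_is_iso (X Y Z : NDG) :
  @is_iso NDG _ _ (assoc_hom X Y Z).
Proof.
exists (assoc_inv X Y Z); split.
  by apply: tensor_hom_ext3 => a b c /=; rewrite assoc_homE assoc_invE.
apply: tensor_hom_ext => a y.
apply: (tensor_ext (f := assoc_hom X Y Z \o assoc_inv X Y Z \o @pure _ X (tensor_dg Y Z) a)
                   (g := @pure _ X (tensor_dg Y Z) a)) => b c /=.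
by rewrite assoc_invE assoc_homE.
Qed.

Lemma lunit_is_iso (X : NDG) : @is_iso NDG _ _ (lunit_hom X).
Proof.
exists (lunit_inv X); split; last first.
  by apply: nilDgHom_eq => a /=; rewrite lunit_homE scale1r.
apply: tensor_hom_ext => c a /=; rewrite lunit_homE.
by rewrite [c in RHS]unit_dgE linearZl_LR linearZr_LR.
Qed.

Lemma runit_is_iso (X : NDG) : @is_iso NDG _ _ (runit_hom X).
Proof.
exists (runit_inv X); split; last first.
  by apply: nilDgHom_eq => a /=; rewrite runit_homE scale1r.
apply: tensor_hom_ext => a c /=; rewrite runit_homE.
by rewrite [c in RHS]unit_dgE linearZl_LR linearZr_LR.
Qed.

Program Definition nd_monoidal : monoidal NDG :=
  @Monoidal NDG (@tensor_dg k) (fun X Y X' Y' f g => tensor_map f g)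
    (unit_dg k) (@assoc_hom k) (@lunit_hom k) (@runit_hom k)
    _ _ _ _ _ assoc_is_iso lunit_is_iso runit_is_iso _ _.
Next Obligation.
by move=> X Y; apply: tensor_hom_ext => a b /=; rewrite tensor_mapE.
Qed.
Next Obligation.
by move=> *; apply: tensor_hom_ext => a b /=; rewrite !tensor_mapE.
Qed.
Next Obligation.
move=> *; apply: tensor_hom_ext3 => a b c /=.
by rewrite !(assoc_homE, tensor_mapE).
Qed.
Next Obligation.
by move=> *; apply: tensor_hom_ext => a b /=; rewrite tensor_mapE !lunit_homE linearZ.
Qed.
Next Obligation.
by move=> *; apply: tensor_hom_ext => a b /=; rewrite tensor_mapE !runit_homE linearZ.
Qed.
Next Obligation.
move=> *; apply: tensor_hom_ext4 => a b c d /=.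
by rewrite !(assoc_homE, tensor_mapE).
Qed.
Next Obligation.
move=> *; apply: tensor_hom_ext3 => a c b /=.
rewrite !(assoc_homE, tensor_mapE) lunit_homE runit_homE.
by rewrite linearZl_LR linearZr_LR.
Qed.

Program Definition nd_symMonoidal : symMonoidal NDG :=
  @SymMonoidal NDG nd_monoidal (@braid_hom k) _ _ _.
Next Obligation.
move=> X Y X' Y' f g; apply: tensor_hom_hext => i j a b ai bj /=.
rewrite tensor_mapE (braid_homE _ ai) (braid_homE _ (nd_fun_piece f ai)).
by rewrite tensor_mapE gsign_hom.
Qed.
Next Obligation.
move=> X Y; apply: tensor_hom_hext => i j a b ai bj /=.
rewrite (braid_homE _ ai) (gsignE _ bj) linearZl_LR linearZZ (braid_homE _ bj).
by rewrite (gsignE _ ai) linearZl_LR scalerA [j * i]mulrC koszul_sqr scale1r.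
Qed.
Next Obligation.
move=> X Y Z; apply: tensor_hom_hext3 => i j l a b c ai bj cl /=.
(* Both sides send a (x) b (x) c to s_i b (x) (s_i c (x) a): the hexagon amounts to the diagonal
   action of s_i on Y (x) Z. *)
rewrite !(assoc_homE, tensor_mapE) !(braid_homE _ ai) gsign_tensor.
by rewrite !(assoc_homE, tensor_mapE) !(braid_homE _ ai).
Qed.

End Monoidal.

Lemma nd_symMonoidal_graded_tensor (k : fieldType) :
  @is_graded_tensor k (nd_symMonoidal k) (fun A B => @pure k A B)
    (1 : unit_dg k).
Proof.
split.
- move=> A B Z g; exists (tlift g); split; first by move=> v w; rewrite tliftE.
  move=> h hE; apply: linear_eq; apply: tensor_ext => v w.
  by rewrite tliftE hE.
- by move=> A B i j a b; apply: tpiece_pure.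
- by move=> A B i a b ai; rewrite [LHS]tdiffE (gsignE _ ai) linearZl_LR mul1r.
- by move=> A B A' B' f g a b; apply: tensor_mapE.
- move=> x; exists x; split; first exact: unit_dgE.
  by move=> c ->; rewrite -unit_dgE.
- by [].
- by move=> A B C a b c; apply: assoc_homE.
- by move=> A a; rewrite [LHS]lunit_homE scale1r.
- by move=> A a; rewrite [LHS]runit_homE scale1r.
- move=> A B i j a b ai bj.
  by rewrite [LHS](braid_homE _ ai) (gsignE _ bj) linearZl_LR.
Qed.

(** * Monoids and algebras *)

Lemma dgaOn_eq (k : fieldType) (A : nilDgVect k) (D D' : dgaOn A) :
  dga_mul D =2 dga_mul D' -> dga_one D = dga_one D' -> D = D'.
Proof.
case: D D' => [m u p1 p2 p3 p4 p5 p6] [m' u' p1' p2' p3' p4' p5' p6'] /=.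
move=> /bilinear_eq mE uE.
case: _ / mE p1' p2' p3' p4' p6' => p1' p2' p3' p4' p6'.
case: _ / uE p2' p3' p5' => p2' p3' p5'.
by congr DgaOn; apply: Prop_irrelevance.
Qed.

(** Leibniz applied to 1 = 1 1, with 1 in degree 0, gives d1 = d1 + d1. This is what makes the unit
    map k -> A commute with the differentials, the one of k being 0. *)
Lemma dga_diff1 (k : fieldType) (A : nilDgVect k) (D : dgaOn A) :
  diff A (dga_one D) = 0.
Proof.
have := dga_leibniz D (dga_one D) (dga_one_degree D).
rewrite dga_mul1l dga_mul1r dga_mul1l koszul0 scale1r => /eqP.
by rewrite addrC -subr_eq subrr => /eqP.
Qed.

Lemma hom_app (k : fieldType) (X Y : nilDgVect k) (f g : nilDgHom X Y) :
  f = g -> forall x, f x = g x.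
Proof. by move=> ->. Qed.

Section DgaOfMul.
Variables (k : fieldType) (A : nilDgVect k) (m : nilDgHom (tensor_dg A A) A) (u : A).
Hypothesis mA : forall a b c, m (pure a (m (pure b c))) = m (pure (m (pure a b)) c).
Hypothesis m1l : forall a, m (pure u a) = a.
Hypothesis m1r : forall a, m (pure a u) = a.
Hypothesis u_degree : piece A 0 u.

Lemma mul_linearl b : linear (fun a => m (pure a b)).
Proof. by move=> c x y; rewrite linearPl linearP. Qed.

Lemma mul_linearr a : linear (fun b => m (pure a b)).
Proof. by move=> c x y; rewrite linearPr linearP. Qed.

Definition mul_bilinear : {bilinear A -> A -> A} := bilinear_of mul_linearl mul_linearr.

Lemma mul_degree i j a b :
  piece A i a -> piece A j b -> piece A (i + j) (mul_bilinear a b).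
Proof. by move=> ai bj; apply: nd_fun_piece; apply: tpiece_pure. Qed.

Lemma mul_leibniz i a b : piece A i a ->
  diff A (mul_bilinear a b) =
  mul_bilinear (diff A a) b + koszul k i *: mul_bilinear a (diff A b).
Proof.
move=> ai; rewrite /= (nd_fun_diff m) [diff _ _]tdiffE linearD (gsignE _ ai).
by rewrite linearZl_LR linearZZ mul1r.
Qed.

Definition dga_of_mul : dgaOn A :=
  @DgaOn k A mul_bilinear u mA m1l m1r mul_degree u_degree mul_leibniz.

End DgaOfMul.

Section MulOfDga.
Variables (k : fieldType) (A : nilDgVect k) (D : dgaOn A).

(** The Leibniz rule freed from homogeneity: both sides are additive in [a], and s_1 produces the
    sign. This is the hypothesis that [tensor_lift] asks for. *)
Lemma dga_mul_diff a b : diff A (dga_mul D a b) =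
  dga_mul D (diff A a) b + dga_mul D (gsign A 1 a) (diff A b).
Proof.
elim/graded_ind: a => [|x y xP yP|i a ai].
- by rewrite !linear0 !linear0l linear0 addr0.
- by rewrite !linearD !linearDl linearD xP yP addrACA.
by rewrite (dga_leibniz D _ ai) (gsignE _ ai) linearZl_LR mul1r.
Qed.

Definition mul_of_dga : nilDgHom (tensor_dg A A) A :=
  tensor_lift (@dga_mul_degree _ _ D) dga_mul_diff.

Lemma mul_of_dgaE a b : mul_of_dga (pure a b) = dga_mul D a b.
Proof. exact: tensor_liftE. Qed.

Lemma one_linear : linear (fun c : unit_dg k => (c : k) *: dga_one D).
Proof. by move=> e u v /=; rewrite scalerDl scalerA. Qed.

Lemma one_degree : of_degree 0 (linear_of one_linear).
Proof.
move=> i c ci /=; rewrite addr0; have [->|i0] := eqVneq i 0.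
  by apply: pieceZ; apply: dga_one_degree.
by rewrite (ci i0) scale0r; apply: piece0.
Qed.

Lemma one_diff c :
  diff A (linear_of one_linear c) = linear_of one_linear (diff (unit_dg k) c).
Proof. by rewrite /= linearZZ dga_diff1 scaler0 scale0r. Qed.

Definition one_of_dga : nilDgHom (unit_dg k) A := NilDgHom one_degree one_diff.

End MulOfDga.

Section MonoidDga.
Variable k : fieldType.
Local Notation NDG := (NilDgVectCat k).
Local Notation S := (nd_symMonoidal k).
Local Open Scope cat_scope.
Local Obligation Tactic := idtac.

Section DgaOfMonoid.
Variable M : monoid S.
Let A : nilDgVect k := mon_ob M.
Let m : nilDgHom (tensor_dg A A) A := mon_mul M.
Let u : A := (mon_one M : nilDgHom (unit_dg k) A) 1.

Lemma monoid_mulA a b c : m (pure a (m (pure b c))) = m (pure (m (pure a b)) c).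
Proof.
have /= := hom_app (X := tensor_dg (tensor_dg A A) A) (mon_mulA M) (pure (pure a b) c).
by rewrite assoc_homE !tensor_mapE => ->.
Qed.

Lemma monoid_mul1l a : m (pure u a) = a.
Proof.
have /= := hom_app (X := tensor_dg (unit_dg k) A) (mon_mul1l M) (pure (1 : unit_dg k) a).
by rewrite tensor_mapE lunit_homE scale1r.
Qed.

Lemma monoid_mul1r a : m (pure a u) = a.
Proof.
have /= := hom_app (X := tensor_dg A (unit_dg k)) (mon_mul1r M) (pure a (1 : unit_dg k)).
by rewrite tensor_mapE runit_homE scale1r.
Qed.

Lemma monoid_one_degree : piece A 0 u.
Proof. exact: (@nd_fun_piece _ (unit_dg k)). Qed.

Definition dgaOn_of_monoid : dgaOn A :=
  dga_of_mul monoid_mulA monoid_mul1l monoid_mul1r monoid_one_degree.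

End DgaOfMonoid.

Program Definition dga_of_monoid : functor (MonoidCat S) (NilDgaCat k) :=
  @Functor (MonoidCat S) (NilDgaCat k) (fun M => NilDga (dgaOn_of_monoid M))
    (fun M N f => @NilDgaHom k _ _ (mon_hom f) _ _) _ _.
Next Obligation.
move=> M N f a b /=.
have /= := hom_app (X := tensor_dg (mon_ob M) (mon_ob M)) (mon_homM f) (pure a b).
by rewrite tensor_mapE.
Qed.
Next Obligation.
move=> M N f /=.
exact: (hom_app (X := unit_dg k) (mon_hom1 f) 1).
Qed.
Next Obligation. by move=> M; apply: nilDgaHom_eq. Qed.
Next Obligation. by move=> *; apply: nilDgaHom_eq. Qed.

Program Definition monoid_of_dga_ob (A : nilDga k) : monoid S :=
  @Defs.Monoid NDG S (dga_vect A) (mul_of_dga (dga_str A)) (one_of_dga (dga_str A)) _ _ _.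
Next Obligation.
move=> A; apply: tensor_hom_ext3 => a b c /=.
by rewrite !(assoc_homE, tensor_mapE, mul_of_dgaE) dga_mulA.
Qed.
Next Obligation.
move=> A; apply: tensor_hom_ext => c a /=.
by rewrite tensor_mapE mul_of_dgaE lunit_homE /= linearZl_LR dga_mul1l.
Qed.
Next Obligation.
move=> A; apply: tensor_hom_ext => a c /=.
by rewrite tensor_mapE mul_of_dgaE runit_homE /= linearZr_LR dga_mul1r.
Qed.

Program Definition monoid_of_dga : functor (NilDgaCat k) (MonoidCat S) :=
  @Functor (NilDgaCat k) (MonoidCat S) monoid_of_dga_ob
    (fun A B f => @MonoidHom NDG S (monoid_of_dga_ob A) (monoid_of_dga_ob B) (dga_fun f) _ _) _ _.
Next Obligation.
move=> A B f; apply: tensor_hom_ext => a b /=.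
by rewrite tensor_mapE !mul_of_dgaE; apply: dga_funM.
Qed.
Next Obligation.
move=> A B f; apply: nilDgHom_eq => c /=; rewrite linearZZ; congr (_ *: _).
exact: dga_fun1.
Qed.
Next Obligation. by move=> A; apply: monoid_hom_eq. Qed.
Next Obligation. by move=> *; apply: monoid_hom_eq. Qed.

Lemma monoid_eq (X : NDG) (m m' : Defs.hom (tens S X X) X) (u u' : Defs.hom (unitc S) X)
    mA m1 m2 mA' m1' m2' : m = m' -> u = u' ->
  @Defs.Monoid NDG S X m u mA m1 m2 = @Defs.Monoid NDG S X m' u' mA' m1' m2'.
Proof.
move=> mE uE; case: _ / mE mA' m1' m2' => mA' m1' m2'.
case: _ / uE m1' m2' => m1' m2'.
by congr Defs.Monoid; apply: Prop_irrelevance.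
Qed.

(** On a fixed object the product is determined by its values on pure tensors and the unit map by
    its value at 1, so the round trip is an equality and not merely an isomorphism. *)
Lemma dga_of_monoidK M : monoid_of_dga (dga_of_monoid M) = M.
Proof.
case: M => X m u mA m1 m2; apply: monoid_eq.
  by apply: tensor_hom_ext => a b; rewrite mul_of_dgaE.
apply: nilDgHom_eq => c /=.
by rewrite [c in RHS]unit_dgE linearZZ.
Qed.

Lemma monoid_of_dgaK A : dga_of_monoid (monoid_of_dga A) = A.
Proof.
case: A => A D; congr NilDga; apply: dgaOn_eq => /=.
  by move=> a b; rewrite /= mul_of_dgaE.
by rewrite scale1r.
Qed.

(** Equality in the dependent pair yields an equality up to transport along a loop at (X, Y), and
    proof irrelevance turns that loop into reflexivity. *)
Lemma arr_inj (C : category) (X Y : C) (f g : Defs.hom X Y) : arr f = arr g -> f = g.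
Proof.
move=> fg; have := projT2_eq fg.
by rewrite (Prop_irrelevance (projT1_eq fg) erefl).
Qed.

(** The round trips between monoids and algebras fix objects only propositionally, yet leave
    underlying maps unchanged by computation. Comparing arrows after a faithful forgetful functor
    avoids transporting morphisms along those equalities. *)
Lemma arr_faithful (C D : category) (U : functor C D) :
  (forall (X Y : C) (f g : Defs.hom X Y), fmap U f = fmap U g -> f = g) ->
  forall (X Y X' Y' : C) (f : Defs.hom X Y) (g : Defs.hom X' Y'), X = X' -> Y = Y' ->
  arr (fmap U f) = arr (fmap U g) -> arr f = arr g.
Proof.
move=> faithU X Y X' Y' f g eX eY; case: _ / eX g => g; case: _ / eY g => g.
by move/arr_inj/faithU ->.
Qed.

Lemma dga_of_monoid_iso : is_cat_isomorphism dga_of_monoid.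
Proof.
exists monoid_of_dga; split; split.
- exact: dga_of_monoidK.
- move=> M N f; apply: (arr_faithful (U := forget_monoid S)).
  + by move=> *; apply: monoid_hom_eq.
  + exact: dga_of_monoidK.
  + exact: dga_of_monoidK.
  + by [].
- exact: monoid_of_dgaK.
- move=> A B f; apply: (arr_faithful (U := forget_dga k)).
  + by move=> *; apply: nilDgaHom_eq.
  + exact: monoid_of_dgaK.
  + exact: monoid_of_dgaK.
  + by [].
Qed.

End MonoidDga.

(** * Tensor products of algebras *)

Lemma gsign0 (k : fieldType) (A : gradedVect k) (a : A) : gsign A 0 a = a.
Proof.
apply: (graded_ext (f := gsign A 0) (g := idfun)) => i x xi.
by rewrite (gsignE _ xi) mul0r koszul0 scale1r.
Qed.

Section AlgebraTheory.
Variables (k : fieldType) (A : nilDga k).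

Lemma amulA (a b c : A) : amul a (amul b c) = amul (amul a b) c.
Proof. exact: dga_mulA. Qed.

Lemma amul1l (a : A) : amul (aone A) a = a. Proof. exact: dga_mul1l. Qed.
Lemma amul1r (a : A) : amul a (aone A) = a. Proof. exact: dga_mul1r. Qed.

Lemma aone_degree : piece A 0 (aone A). Proof. exact: dga_one_degree. Qed.

Lemma amul_degree i j (a b : A) :
  piece A i a -> piece A j b -> piece A (i + j) (amul a b).
Proof. exact: dga_mul_degree. Qed.

Lemma amulZl c (a b : A) : amul (c *: a) b = c *: amul a b.
Proof. exact: linearZl_LR. Qed.

Lemma amulZr c (a b : A) : amul a (c *: b) = c *: amul a b.
Proof. exact: linearZr_LR. Qed.

Lemma gsign_aone n : gsign A n (aone A) = aone A.
Proof. by rewrite (gsignE _ aone_degree) mulr0 koszul0 scale1r. Qed.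

(** The product is a morphism A (x) A -> A, hence commutes with s_n, which acts diagonally on the
    source. *)
Lemma gsign_amul n (a b : A) : gsign A n (amul a b) = amul (gsign A n a) (gsign A n b).
Proof.
by rewrite /amul -!mul_of_dgaE -gsign_hom gsign_tensor.
Qed.

End AlgebraTheory.

Section TensorInduction.
Variables (k : fieldType) (A B : gradedVect k).

Lemma tensor_hind (P : tensor A B -> Prop) :
  P 0 -> (forall x y, P x -> P y -> P (x + y)) ->
  (forall i j a b, piece A i a -> piece B j b -> P (pure a b)) -> forall x, P x.
Proof.
move=> P0 PD Pp; apply: tensor_ind => // v w.
rewrite (gproj_sum v) (gproj_sum w) linear_sumlz; elim/big_ind: _ => // i _.
rewrite linear_sumr; elim/big_ind: _ => // j _.
exact: Pp (piece_gproj i v) (piece_gproj j w).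
Qed.

End TensorInduction.

(** * The algebra structure on a tensor product of algebras *)

Section TensorDga.
Variables (k : fieldType) (A B : nilDga k).
Local Notation "A ⊗ B" := (tensor_dg A B) (at level 40, left associativity).
Local Notation T := (A ⊗ B).

Local Notation ndcomp := (@Defs.comp (NilDgVectCat k) _ _ _).
Local Notation ndid X := (@idc (NilDgVectCat k) X).

(** The interchange (a b)(a' b') -> (a a')(b b') of four tensor factors. Composed of structure
    morphisms, it has degree 0 and commutes with the differentials for free, so the Leibniz rule for
    the product on A (x) B needs no computation. *)
Definition swap_middle : nilDgHom (T ⊗ T) ((A ⊗ A) ⊗ (B ⊗ B)) :=
  ndcomp (assoc_inv A A (B ⊗ B))
    (ndcomp (tensor_map (ndid A) (assoc_hom A B B))
      (ndcomp (tensor_map (ndid A) (tensor_map (braid_hom B A) (ndid B)))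
        (ndcomp (tensor_map (ndid A) (assoc_inv B A B)) (assoc_hom A B T)))).

Definition tensor_mul : nilDgHom (T ⊗ T) T :=
  ndcomp (tensor_map (mul_of_dga (dga_str A)) (mul_of_dga (dga_str B))) swap_middle.

Lemma tensor_mulE j a b a' b' : piece B j b ->
  tensor_mul (pure (pure a b) (pure a' b')) =
  pure (amul a (gsign A j a')) (amul b b').
Proof.
move=> bj; rewrite /= !(assoc_homE, tensor_mapE, assoc_invE) /= (braid_homE _ bj).
by rewrite !(assoc_homE, tensor_mapE, assoc_invE, mul_of_dgaE).
Qed.

Definition tensor_one : T := pure (aone A) (aone B).

Local Notation "x ·  y" := (tensor_mul (pure x y)) (at level 40).

Lemma tensor_mulA x y z : x · (y · z) = (x · y) · z.
Proof.
elim/tensor_hind: x => [|x x' xP x'P|i j a b ai bj].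
- by rewrite !(linear0l, linear0).
- by rewrite !(linearDl, linearD) xP x'P.
elim/tensor_hind: y => [|y y' yP y'P|i' j' a' b' ai' bj'].
- by rewrite !(linear0l, linear0r, linear0).
- by rewrite !(linearDl, linearDr, linearD) yP y'P.
elim/tensor_hind: z => [|z z' zP z'P|i'' j'' a'' b'' _ _].
- by rewrite !(linear0r, linear0).
- by rewrite !(linearDr, linearD) zP z'P.
(* For b and b' of degrees j and j', both sides equal a (s_j a') (s_(j+j') a'') (x) b b' b''. *)
rewrite !(tensor_mulE _ _ _ bj', tensor_mulE _ _ _ bj).
rewrite (tensor_mulE _ _ _ (amul_degree bj bj')).
by rewrite gsign_amul gsignD !amulA.
Qed.

Lemma tensor_mul1l x : tensor_one · x = x.
Proof.
elim/tensor_hind: x => [|x y xP yP|i j a b ai bj].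
- by rewrite linear0r linear0.
- by rewrite linearDr linearD xP yP.
by rewrite (tensor_mulE _ _ _ (aone_degree B)) gsign0 !amul1l.
Qed.

Lemma tensor_mul1r x : x · tensor_one = x.
Proof.
elim/tensor_hind: x => [|x y xP yP|i j a b ai bj].
- by rewrite linear0l linear0.
- by rewrite linearDl linearD xP yP.
by rewrite (tensor_mulE _ _ _ bj) gsign_aone !amul1r.
Qed.

Lemma tensor_one_degree : piece T 0 tensor_one.
Proof. exact: (tpiece_pure (aone_degree A) (aone_degree B)). Qed.

Definition tensor_dgaOn : dgaOn T :=
  dga_of_mul tensor_mulA tensor_mul1l tensor_mul1r tensor_one_degree.

Definition tensor_dga : nilDga k := NilDga tensor_dgaOn.

Lemma tensor_amulE j (a a' : A) (b b' : B) : piece B j b ->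
  @amul _ tensor_dga (pure a b) (pure a' b') =
  pure (amul a (gsign A j a')) (amul b b').
Proof. exact: tensor_mulE. Qed.

Lemma tensor_aoneE : aone tensor_dga = pure (aone A) (aone B).
Proof. by []. Qed.

Section HomFrom.
Variables (Z : nilDga k) (h : nilDgHom T Z).
Hypothesis hM : forall i j i' j' (a a' : A) (b b' : B),
  piece A i a -> piece B j b -> piece A i' a' -> piece B j' b' ->
  h (pure (amul a (gsign A j a')) (amul b b')) =
  amul (h (pure a b)) (h (pure a' b')).

Lemma tensor_dga_homM (x y : tensor_dga) : h (amul x y) = amul (h x) (h y).
Proof.
rewrite /amul; elim/tensor_hind: x => [|x x' xP x'P|i j a b ai bj].
- by rewrite !(linear0l, linear0).
- by rewrite !(linearDl, linearD) xP x'P.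
elim/tensor_hind: y => [|y y' yP y'P|i' j' a' b' ai' bj'].
- by rewrite !(linear0r, linear0).
- by rewrite !(linearDr, linearD) yP y'P.
by rewrite -/(@amul _ tensor_dga _ _) (tensor_amulE _ _ _ bj) (hM ai bj ai' bj').
Qed.

End HomFrom.

End TensorDga.

(** * The symmetric monoidal structure on Nil-dga *)

Section DgaMonoidal.
Variable k : fieldType.
Local Notation NDG := (NilDgVectCat k).
Local Notation DGA := (NilDgaCat k).
Local Open Scope cat_scope.
Local Obligation Tactic := idtac.

Section DgaMap.
Variables (A B A' B' : nilDga k) (f : nilDgaHom A A') (g : nilDgaHom B B').

Lemma dga_mapM (x y : tensor_dga A B) :
  tensor_map f g (amul x y) =
  @amul _ (tensor_dga A' B') (tensor_map f g x) (tensor_map f g y).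
Proof.
apply: (@tensor_dga_homM _ _ _ (tensor_dga A' B')) => i j i' j' a a' b b' ai bj ai' bj'.
by rewrite !tensor_mapE (tensor_amulE _ _ _ (nd_fun_piece g bj)) !dga_funM gsign_hom.
Qed.

Lemma dga_map1 : tensor_map f g (aone (tensor_dga A B)) = aone (tensor_dga A' B').
Proof. by rewrite !tensor_aoneE tensor_mapE !dga_fun1. Qed.

Definition dga_map : nilDgaHom (tensor_dga A B) (tensor_dga A' B') :=
  @NilDgaHom k (tensor_dga A B) (tensor_dga A' B') (tensor_map f g) dga_mapM dga_map1.

End DgaMap.

Section UnitDga.

Local Notation I := (unit_dg k).

Lemma unit_dga_mulA a b c :
  lunit_hom I (pure a (lunit_hom I (pure b c))) =
  lunit_hom I (pure (lunit_hom I (pure a b)) c).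
Proof. by rewrite !lunit_homE scalerA. Qed.

Lemma unit_dga_mul1l a : lunit_hom I (pure (1 : I) a) = a.
Proof. by rewrite lunit_homE scale1r. Qed.

Lemma unit_dga_mul1r a : lunit_hom I (pure a (1 : I)) = a.
Proof. by rewrite lunit_homE -unit_dgE. Qed.

Lemma unit_one_degree : piece I 0 1. Proof. by []. Qed.

(** The product of k is taken to be the left unitor of the unit object, a morphism already, so its
    degree and Leibniz conditions come with it. *)
Definition unit_dgaOn : dgaOn I :=
  @dga_of_mul k I (lunit_hom I) 1 unit_dga_mulA unit_dga_mul1l unit_dga_mul1r
    unit_one_degree.

Definition unit_dga : nilDga k := NilDga unit_dgaOn.

Lemma unit_amulE (c d : unit_dga) : amul c d = (c : k) *: (d : k^o).
Proof. exact: lunit_homE. Qed.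

Lemma gsign_unit n (c : unit_dga) : gsign I n c = c.
Proof. by rewrite (@gsignE _ I n 0) ?mulr0 ?koszul0 ?scale1r. Qed.

End UnitDga.

Section Constraints.

Section Assoc.
Variables A B C : nilDga k.

Lemma assoc_dgaM (x y : tensor_dga (tensor_dga A B) C) :
  assoc_hom A B C (amul x y) =
  @amul _ (tensor_dga A (tensor_dga B C)) (assoc_hom A B C x) (assoc_hom A B C y).
Proof.
apply: (@tensor_dga_homM _ (tensor_dga A B) C (tensor_dga A (tensor_dga B C))).
move=> i l i' l' u u' c c' ui cl u'i' c'l'.
move: u ui; apply: tpiece_ind => [|u v uP vP|m n a b _ am bn].
- by rewrite /amul !(linear0l, linear0).
- by rewrite /amul !(linearDl, linearD) -/amul uP vP.
move: u' u'i'; apply: tpiece_ind => [|u v uP vP|m' n' a' b' _ _ _].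
- by rewrite /amul !(linear0l, linear0r, linear0).
- by rewrite /amul !(linearDl, linearDr, linearD) -/amul uP vP.
(* With b in degree n and c in degree l, the left bracketing gives s_n s_l a' and the right one
   s_(n+l) a'; the factor s_l b' is common to both. *)
rewrite gsign_tensor (tensor_amulE _ _ _ bn) !assoc_homE.
rewrite (@tensor_amulE _ A (tensor_dga B C) (n + l)); last exact: tpiece_pure.
by rewrite (tensor_amulE _ _ _ cl) gsignD.
Qed.

Lemma assoc_dga1 : assoc_hom A B C (aone (tensor_dga (tensor_dga A B) C)) =
  aone (tensor_dga A (tensor_dga B C)).
Proof. by rewrite !tensor_aoneE assoc_homE. Qed.

Definition assoc_dga :
    nilDgaHom (tensor_dga (tensor_dga A B) C) (tensor_dga A (tensor_dga B C)) :=
  @NilDgaHom k (tensor_dga (tensor_dga A B) C) (tensor_dga A (tensor_dga B C))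
    (assoc_hom A B C) assoc_dgaM assoc_dga1.

End Assoc.

Section Unitors.
Variable A : nilDga k.

Lemma lunit_dgaM (x y : tensor_dga unit_dga A) :
  lunit_hom A (amul x y) = amul (lunit_hom A x) (lunit_hom A y).
Proof.
apply: (@tensor_dga_homM _ unit_dga A A) => i j i' j' c c' a a' _ _ _ _.
by rewrite gsign_unit unit_amulE !lunit_homE amulZl amulZr scalerA.
Qed.

Lemma lunit_dga1 : lunit_hom A (aone (tensor_dga unit_dga A)) = aone A.
Proof. by rewrite tensor_aoneE lunit_homE scale1r. Qed.

Definition lunit_dga : nilDgaHom (tensor_dga unit_dga A) A :=
  @NilDgaHom k (tensor_dga unit_dga A) A (lunit_hom A) lunit_dgaM lunit_dga1.

Lemma runit_dgaM (x y : tensor_dga A unit_dga) :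
  runit_hom A (amul x y) = amul (runit_hom A x) (runit_hom A y).
Proof.
apply: (@tensor_dga_homM _ A unit_dga A) => i j i' j' a a' c c' _ cj _ _.
rewrite unit_amulE !runit_homE amulZl amulZr scalerA.
(* The scalar c has passed a' with sign operator s_j: either j = 0 and s_j is the identity, or c =
   0. *)
have [->|j0] := eqVneq j 0; first by rewrite gsign0.
by rewrite (cj j0) !mul0r !scale0r.
Qed.

Lemma runit_dga1 : runit_hom A (aone (tensor_dga A unit_dga)) = aone A.
Proof. by rewrite tensor_aoneE runit_homE scale1r. Qed.

Definition runit_dga : nilDgaHom (tensor_dga A unit_dga) A :=
  @NilDgaHom k (tensor_dga A unit_dga) A (runit_hom A) runit_dgaM runit_dga1.

End Unitors.

Section Braid.
Variables A B : nilDga k.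

Lemma braid_dgaM (x y : tensor_dga A B) :
  braid_hom A B (amul x y) = @amul _ (tensor_dga B A) (braid_hom A B x) (braid_hom A B y).
Proof.
apply: (@tensor_dga_homM _ A B (tensor_dga B A)) => i j i' j' a a' b b' ai bj ai' _.
(* On the left, the product contributes (-1)^(j i') and the braiding s_(i+i') b = (-1)^(i' j) s_i b;
   the two equal signs cancel, leaving s_i b times s_(i+i') b', as on the right. *)
rewrite (gsignE _ ai') amulZr linearZl_LR linearZZ (braid_homE _ (amul_degree ai ai')).
rewrite (braid_homE _ ai) (braid_homE _ ai') (tensor_amulE _ _ _ ai).
rewrite gsign_amul -gsignD [gsign B (i + i') b](gsignE _ bj) (gsignE _ bj) !amulZl.
rewrite !linearZl_LR scalerA [j * i']mulrC mulrDl koszulD mulrCA koszul_sqr.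
by rewrite mulr1.
Qed.

Lemma braid_dga1 :
  braid_hom A B (aone (tensor_dga A B)) = aone (tensor_dga B A).
Proof. by rewrite !tensor_aoneE (braid_homE _ (aone_degree A)) gsign_aone. Qed.

Definition braid_dga : nilDgaHom (tensor_dga A B) (tensor_dga B A) :=
  @NilDgaHom k (tensor_dga A B) (tensor_dga B A) (braid_hom A B) braid_dgaM braid_dga1.

End Braid.

End Constraints.

(** The forgetful functor reflects isomorphisms: the inverse of a bijective multiplicative unital
    map is again multiplicative and unital. *)
Lemma dga_iso (A B : nilDga k) (f : nilDgaHom A B) :
  @is_iso NDG A B (dga_fun f) -> @is_iso DGA A B f.
Proof.
move=> [g [gf fg]].
have fK x : (g : nilDgHom B A) (f x) = x by exact: (hom_app gf).
have gK x : f ((g : nilDgHom B A) x) = x by exact: (hom_app fg).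
have gM a b : (g : nilDgHom B A) (amul a b) =
    amul ((g : nilDgHom B A) a) ((g : nilDgHom B A) b).
  by rewrite -{1}[a]gK -{1}[b]gK -dga_funM fK.
have g1 : (g : nilDgHom B A) (aone B) = aone A by rewrite -(dga_fun1 f) fK.
by exists (@NilDgaHom k B A g gM g1); split; apply: nilDgaHom_eq.
Qed.

Local Notation S := (nd_symMonoidal k).

(** The structure morphisms are those of Nil-dgvect on underlying objects, and an algebra morphism
    is determined by its underlying map, so each equation is inherited from [nd_symMonoidal] and
    invertibility comes from [dga_iso]. *)
Program Definition dga_monoidal : monoidal DGA :=
  @Monoidal DGA (@tensor_dga k) (fun X Y X' Y' f g => dga_map f g)
    unit_dga assoc_dga lunit_dga runit_dga _ _ _ _ _ _ _ _ _ _.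
Next Obligation. by move=> X Y; apply: nilDgaHom_eq; apply: (tensh1 S). Qed.
Next Obligation. by move=> *; apply: nilDgaHom_eq; apply: (tenshM S). Qed.
Next Obligation. by move=> *; apply: nilDgaHom_eq; apply: (assoc_nat S). Qed.
Next Obligation. by move=> *; apply: nilDgaHom_eq; apply: (lunit_nat S). Qed.
Next Obligation. by move=> *; apply: nilDgaHom_eq; apply: (runit_nat S). Qed.
Next Obligation. by move=> *; apply: dga_iso; apply: assoc_is_iso. Qed.
Next Obligation. by move=> *; apply: dga_iso; apply: lunit_is_iso. Qed.
Next Obligation. by move=> *; apply: dga_iso; apply: runit_is_iso. Qed.
Next Obligation. by move=> *; apply: nilDgaHom_eq; apply: (pentagon S). Qed.
Next Obligation. by move=> *; apply: nilDgaHom_eq; apply: (triangle S). Qed.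

Program Definition dga_symMonoidal : symMonoidal DGA :=
  @SymMonoidal DGA dga_monoidal braid_dga _ _ _.
Next Obligation. by move=> *; apply: nilDgaHom_eq; apply: (braid_nat S). Qed.
Next Obligation. by move=> *; apply: nilDgaHom_eq; apply: (braidK S). Qed.
Next Obligation. by move=> *; apply: nilDgaHom_eq; apply: (hexagon S). Qed.

End DgaMonoidal.

Theorem theorem10 (k : fieldType) :
  exists (S : symMonoidal (NilDgVectCat k))
    (t : forall A B : nilDgVect k,
           {bilinear A -> B -> (tens S A B : nilDgVect k)})
    (e : (unitc S : nilDgVect k)),
    [/\ is_graded_tensor t e,
        exists F : functor (MonoidCat S) (NilDgaCat k),
          [/\ is_cat_isomorphism F,
              functor_eq (comp_functor (forget_dga k) F) (forget_monoid S)
            & forall M : monoid S, exists D : dgaOn (mon_ob M : nilDgVect k),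
                [/\ F M = NilDga D,
                    forall a b : (mon_ob M : nilDgVect k),
                      dga_mul D a b =
                      (mon_mul M : nilDgHom _ _) (t (mon_ob M) (mon_ob M) a b)
                  & dga_one D = (mon_one M : nilDgHom _ _) e]]
      & exists S' : symMonoidal (NilDgaCat k),
          [/\ strict_symMonoidal_functor (forget_dga k) S' S,
              forall A B : nilDga k,
                exists D : dgaOn (tens S A B : nilDgVect k),
                  [/\ tens S' A B = NilDga D,
                      forall (i j : int) (a a' : A) (b b' : B),
                        piece B j b -> piece A i a' ->
                        dga_mul D (t A B a b) (t A B a' b') =
                        koszul k (j * i) *: t A B (amul a a') (amul b b')
                    & dga_one D = t A B (aone A) (aone B)]
            & exists D : dgaOn (unitc S : nilDgVect k),
                [/\ unitc S' = NilDga D, dga_mul D e e = e & dga_one D = e]]].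
Proof.
exists (nd_symMonoidal k), (fun A B => @pure k A B), (1 : unit_dg k).
split; first exact: nd_symMonoidal_graded_tensor.
  exists (dga_of_monoid k); split; first exact: dga_of_monoid_iso.
    (* The functor changes neither underlying objects nor underlying maps, so the triangle of
       functors commutes by computation. *)
    by split.
  by move=> M; exists (dgaOn_of_monoid M); split.
exists (dga_symMonoidal k); split.
(* Forgetting the products returns the tensor products and constraints of Nil-dgvect by computation,
   which is what strictness requires. *)
- by split; split.
- move=> A B; exists (tensor_dgaOn A B); split=> // i j a a' b b' bj ai'.
  rewrite [LHS](tensor_mulE _ _ _ bj) (gsignE _ ai').
  by rewrite amulZr linearZl_LR.
- by exists (unit_dgaOn k); split=> //; rewrite [LHS]unit_dga_mul1l.
Qed.
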